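(* Let $\Delta\in\mathbb{N}$ with $\Delta\ge 3$ and let $\lambda_\Delta:=\frac{(\Delta-1)^{\Delta-1}}{(\Delta-2)^{\Delta}}$. Then there exist $\lambda\in\mathbb{C}$ arbitrarily close to $\lambda_\Delta$ for which there exists a graph $G$ of maximum degree $\Delta$ with $Z_G(\lambda)=0$; that is, for every $\eta>0$ there exist $\lambda\in\mathbb{C}$ with $|\lambda-\lambda_\Delta|<\eta$ and a graph $G$ of maximum degree $\Delta$ such that $Z_G(\lambda)=0$.
   Context: Graphs are finite and simple. For a graph $G=(V,E)$ and $\lambda\in\mathbb{C}$, the (univariate) independence polynomial is $Z_G(\lambda)=\sum_{I}\lambda^{|I|}$, where the sum is over all independent sets $I\subseteq V$ (sets spanning no edge of $G$, including the empty set). *)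

(* Defs.v *)
From HB Require Import structures.
From mathcomp Require Import all_boot all_order all_algebra.
From mathcomp Require Import reals.
From mathcomp Require Import complex.

Set Implicit Arguments.
Unset Strict Implicit.
Unset Printing Implicit Defensive.

Import Order.TTheory GRing.Theory Num.Theory.

Local Open Scope ring_scope.

Record sgraph := SGraph {
  vertex :> finType;
  edge : rel vertex;
  edge_sym : symmetric edge;
  edge_irrefl : irreflexive edge
}.

Definition neighbors (G : sgraph) (v : G) : {set G} := [set w | edge v w].

(* The empty graph gets maximum degree 0. *)
Definition max_degree (G : sgraph) : nat := (\max_(v : G) #|neighbors v|)%N.

Definition independent (G : sgraph) (I : {set G}) : bool :=
  [forall v in I, forall w in I, ~~ edge v w].

Definition indep_poly (C : comNzRingType) (G : sgraph) (lambda : C) : C :=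
  \sum_(I : {set G} | independent I) lambda ^+ #|I|.

(* Natural-number subtraction: the intended range is 3 <= Delta. *)
Definition lambda_crit (R : realType) (Delta : nat) : R :=
  (Delta - 1)%:R ^+ (Delta - 1) / (Delta - 2)%:R ^+ Delta.

(* Main.v *)
Require Import Defs.
From HB Require Import structures.
From mathcomp Require Import reals boolp classical_sets topology normedtype.
From mathcomp Require Import all_boot all_order all_algebra all_solvable all_field.
From mathcomp Require Import derive realfun sequences exp trigo.
From mathcomp Require Import complex zify ring lra.

(** Write Delta = d + 1. A rooted tree in which every vertex that is not a leaf
    has d children has the occupation ratio R_k = Z(root in) / Z(root out),
    with R_0 = l and R_(k+1) = l / (1 + R_k)^d. The real map
    x |-> l / (1 + x)^d has a globally attracting fixed point for l = l_Delta,
    and acquires an attracting two-cycle as soon as l exceeds l_Delta: the even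
    iterates then stay at distance of order sqrt (l - l_Delta) above the
    critical fixed point 1 / (d - 1). So the functions l |-> R_(2k) are not
    uniformly Lipschitz at l_Delta. The proof shows that they would be, if no
    graph of maximum degree Delta had a zero in a disc around l_Delta.

    Suppose that there is such a disc. Hang d - 1 copies of the tree of depth k
    on each vertex of a path. The result has maximum degree Delta, and its
    independence polynomial is, up to a factor without zeros, that of a path
    with the activity mu = l / (1 + R_k)^(d - 1). The zeros of the polynomials
    of paths are the numbers -1 / (4 (cos x)^2) with x a rational multiple of
    pi, and they are dense in the ray from -oo to -1/4
    ([spine_trig], [spine_zeros_dense]). Hence mu, as a function of l on the
    disc, omits this whole ray, with a bound from below on the distance to it
    ([pencil_lower]). On the complement of the ray the ratios of consecutive
    path polynomials converge to (1 + sqrt (1 + 4 mu)) / 2, whose real part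
    exceeds 1/2, so they end up in the right half plane ([spine_slit]).
    A function with nonnegative real part on a disc has a derivative at the
    centre controlled by its value there ([caratheodory], [harnack]). On the
    real line these values lie between 1 and 1 + mu, so mu is Lipschitz at
    l_Delta with a constant that does not depend on k
    ([spine_weight_lipschitz]).

    This is contradicted by real estimates at l_Delta and at the activity
    whose two-step map does not move y = (1 + a) / (d - 1) down: the two activities
    differ by O(a^2) ([two_cycle_activity]), while the limit of mu along even k
    differs by at least a positive multiple of a ([critical_cvg],
    [two_cycle_lower], [no_zero_free_disc]). *)

Set Implicit Arguments.
Unset Strict Implicit.
Unset Printing Implicit Defensive.

Import Order.TTheory GRing.Theory Num.Theory numFieldNormedType.Exports.

Local Open Scope ring_scope.
Local Open Scope complex_scope.

(** * Graphs obtained by joining roots *)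

Record rooted := Rooted { rgraph :> sgraph; root : rgraph }.

Section Attach.

Variables G H : rooted.

Definition attach_edge (u v : G + H) : bool :=
  match u, v with
  | inl a, inl b => edge a b
  | inr a, inr b => edge a b
  | inl a, inr b => (a == root G) && (b == root H)
  | inr b, inl a => (a == root G) && (b == root H)
  end.

Lemma attach_edge_sym : symmetric attach_edge.
Proof. by case=> [a|a] [b|b] //=; apply: edge_sym. Qed.

Lemma attach_edge_irrefl : irreflexive attach_edge.
Proof. by case=> a /=; apply: edge_irrefl. Qed.

(** Joining two rooted graphs by an edge between their roots produces every graph
    needed below. Degrees grow only at the two roots, and an independent set of
    the result is a pair of independent sets that do not both contain the root. *)
Definition attach : rooted :=
  @Rooted (SGraph attach_edge_sym attach_edge_irrefl) (inl (root G)).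

Definition set_sum (I : {set G}) (J : {set H}) : {set attach} :=
  [set u | match u with inl a => a \in I | inr b => b \in J end].

Lemma card_set_sum I J : #|set_sum I J| = (#|I| + #|J|)%N.
Proof.
rewrite -!sum1_card big_sumType /=; congr (_ + _)%N;
  by apply: eq_bigl => a; rewrite !in_set.
Qed.

Lemma set_sum_bij : bijective (fun p : {set G} * {set H} => set_sum p.1 p.2).
Proof.
exists (fun K : {set attach} => ([set a | inl a \in K], [set b | inr b \in K])).
  by case=> I J /=; congr pair; apply/setP => a; rewrite !inE.
by move=> K; apply/setP => -[a|a]; rewrite !inE /= ?inE.
Qed.

Lemma independent_set_sum I J : independent (set_sum I J) =
  [&& independent I, independent J & ~~ ((root G \in I) && (root H \in J))].
Proof.
apply/'forall_implyP/and3P => [indK | [/'forall_implyP iI /'forall_implyP iJ nr]].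
  split.
  - apply/'forall_implyP => a aI; apply/'forall_implyP => b bI.
    have /indK/'forall_implyP ia : inl a \in set_sum I J by rewrite inE.
    by apply: (ia (inl b)); rewrite inE.
  - apply/'forall_implyP => a aI; apply/'forall_implyP => b bI.
    have /indK/'forall_implyP ia : inr a \in set_sum I J by rewrite inE.
    by apply: (ia (inr b)); rewrite inE.
  - apply/negP => /andP[rI rJ].
    have /indK/'forall_implyP ia : inl (root G) \in set_sum I J by rewrite inE.
    have /ia : inr (root H) \in set_sum I J by rewrite inE.
    by rewrite /= !eqxx.
case=> a; rewrite inE => aI; apply/'forall_implyP => -[b|b]; rewrite inE => bI /=.
- exact: (implyP (forallP (iI a aI) b) bI).
- by apply: contra nr => /andP[/eqP<- /eqP<-]; rewrite aI bI.
- by apply: contra nr => /andP[/eqP<- /eqP<-]; rewrite aI bI.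
- exact: (implyP (forallP (iJ a aI) b) bI).
Qed.

Lemma neighbors_attach_l (a : G) :
  #|neighbors (inl a : attach)| = (#|neighbors a| + (a == root G))%N.
Proof.
have -> : neighbors (inl a : attach) =
    set_sum (neighbors a) (if a == root G then [set root H] else set0).
  apply/setP => -[b|b]; rewrite !inE //=.
  by case: (a == root G); rewrite /= !inE.
by rewrite card_set_sum; case: (a == root G); rewrite ?cards1 ?cards0.
Qed.

Lemma neighbors_attach_r (b : H) :
  #|neighbors (inr b : attach)| = (#|neighbors b| + (b == root H))%N.
Proof.
have -> : neighbors (inr b : attach) =
    set_sum (if b == root H then [set root G] else set0) (neighbors b).
  apply/setP => -[a|a]; rewrite !inE //=.
  by case: (b == root H); rewrite /= !inE ?andbT ?andbF.
by rewrite card_set_sum addnC; case: (b == root H); rewrite ?cards1 ?cards0.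
Qed.

End Attach.

Definition root_degree (G : rooted) : nat := #|neighbors (root G)|.

(** Only the degree of the root changes, and since it grows, its old value may
    stay in the maximum. *)
Lemma max_degree_bump (G : rooted) :
  (\max_(a : G) (#|neighbors a| + (a == root G)))%N =
  maxn (max_degree G) (root_degree G).+1.
Proof.
rewrite /max_degree (bigD1 (root G)) //= [in RHS](bigD1 (root G)) //= eqxx addn1.
rewrite [X in maxn _ X](eq_bigr (fun a : G => #|neighbors a|)); last first.
  by move=> a /negbTE ->; rewrite addn0.
by rewrite /root_degree; lia.
Qed.

Lemma root_degree_attach G H : root_degree (attach G H) = (root_degree G).+1.
Proof. by rewrite /root_degree neighbors_attach_l eqxx addn1. Qed.

Lemma max_degree_attach G H : max_degree (attach G H) =
  maxn (maxn (max_degree G) (root_degree G).+1)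
       (maxn (max_degree H) (root_degree H).+1).
Proof.
rewrite -!max_degree_bump /max_degree big_sumType /=.
by congr maxn; apply: eq_bigr => a _;
  rewrite ?(neighbors_attach_l H a) ?(neighbors_attach_r G a).
Qed.

Section RootedPoly.

Variables (C : comNzRingType) (x : C).

Definition poly_in (G : rooted) : C :=
  \sum_(I : {set G} | independent I && (root G \in I)) x ^+ #|I|.
Definition poly_out (G : rooted) : C :=
  \sum_(I : {set G} | independent I && (root G \notin I)) x ^+ #|I|.

Lemma indep_polyE (G : rooted) : indep_poly G x = poly_in G + poly_out G.
Proof. by rewrite /indep_poly (bigID (fun I : {set G} => root G \in I)). Qed.

Lemma sum_attach G H (P : pred {set attach G H}) :
  \sum_(K : {set attach G H} | P K) x ^+ #|K| =
  \sum_(I : {set G}) \sum_(J : {set H} | P (set_sum I J)) x ^+ #|I| * x ^+ #|J|.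
Proof.
rewrite pair_big_dep /= (reindex _ (onW_bij _ (set_sum_bij G H))) /=.
by apply: eq_bigr => p _; rewrite card_set_sum exprD.
Qed.

Lemma poly_in_attach G H : poly_in (attach G H) = poly_in G * poly_out H.
Proof.
rewrite /poly_in sum_attach [in RHS]big_mkcond big_distrl /=; apply: eq_bigr => I _.
case: ifP => cI.
  rewrite big_distrr; apply: eq_bigl => J /=.
  by rewrite independent_set_sum inE; case/andP: cI => -> ->; rewrite /= andbT.
rewrite mul0r big_pred0 // => J; rewrite independent_set_sum inE.
by move: cI; case: (independent I); case: (root G \in I); rewrite ?andbF.
Qed.

Lemma poly_out_attach G H :
  poly_out (attach G H) = poly_out G * (poly_in H + poly_out H).
Proof.
rewrite /poly_out sum_attach [in RHS]big_mkcond big_distrl /=; apply: eq_bigr => I _.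
case: ifP => cI.
  rewrite -indep_polyE /indep_poly big_distrr; apply: eq_bigl => J /=.
  by rewrite independent_set_sum inE; case/andP: cI => -> /negbTE ->; rewrite /= !andbT.
rewrite mul0r big_pred0 // => J; rewrite independent_set_sum inE.
by move: cI; case: (independent I); case: (root G \in I); rewrite ?andbF.
Qed.

End RootedPoly.

Lemma no_edge_sym : symmetric (fun _ _ : unit => false). Proof. by []. Qed.
Lemma no_edge_irrefl : irreflexive (fun _ : unit => xpred0 : pred unit).
Proof. by []. Qed.

Definition single : rooted := @Rooted (SGraph no_edge_sym no_edge_irrefl) tt.

Lemma independent_single (I : {set single}) : independent I.
Proof. by apply/'forall_implyP => a _; apply/'forall_implyP. Qed.

Lemma poly_in_single (C : comNzRingType) (x : C) : poly_in x single = x.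
Proof.
rewrite /poly_in (big_pred1 [set tt]) ?cards1 // => I.
rewrite independent_single /=; apply/idP/eqP => [tI|->]; last by rewrite inE.
by apply/setP => -[]; rewrite inE tI.
Qed.

Lemma poly_out_single (C : comNzRingType) (x : C) : poly_out x single = 1.
Proof.
rewrite /poly_out (big_pred1 set0) ?cards0 // => I.
rewrite independent_single /=; apply/idP/eqP => [tI|->]; last by rewrite inE.
by apply/setP => -[]; rewrite inE (negbTE tI).
Qed.

Lemma degree_single : (max_degree single = 0%N) * (root_degree single = 0%N).
Proof.
have d0 (a : single) : #|neighbors a| = 0%N.
  by apply/eqP; rewrite cards_eq0; apply/eqP/setP => b; rewrite !inE.
by split; rewrite /root_degree ?d0 // /max_degree big1.
Qed.

Definition join_copies (d : nat) (H : rooted) : rooted := iter d (attach^~ H) single.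

(** Dividing the two formulas shows that the ratio R = poly_in / poly_out becomes
    x / (1 + R)^d. *)
Lemma join_copies_polys d H (C : comNzRingType) (x : C) :
  (poly_in x (join_copies d H) = x * poly_out x H ^+ d) *
  (poly_out x (join_copies d H) = (poly_in x H + poly_out x H) ^+ d).
Proof.
elim: d => [|d [IHi IHo]]; first by rewrite poly_in_single poly_out_single !expr0 mulr1.
by rewrite /= poly_in_attach poly_out_attach IHi IHo -mulrA !exprSr.
Qed.

Lemma join_copies_degree d H : (root_degree (join_copies d H) = d) *
  (max_degree (join_copies d H) =
     if d is 0 then 0%N else maxn d (maxn (max_degree H) (root_degree H).+1)).
Proof.
have rd : root_degree (join_copies d H) = d.
  by elim: d => [|d IH]; rewrite ?degree_single //= root_degree_attach IH.
split=> //; elim: d rd => [|d IH] rd; first by rewrite degree_single.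
have rd' : root_degree (join_copies d H) = d by move: rd; rewrite /= root_degree_attach => -[].
rewrite /= max_degree_attach rd' (IH rd'); case: d {IH rd rd'} => *; lia.
Qed.

Fixpoint cayley (d k : nat) : rooted :=
  if k is k'.+1 then join_copies d (cayley d k') else single.

(** The spine has n + 1 vertices. The pendant trees give its interior vertices
    degree d + 1 and turn the activity x of the path into x / (1 + R)^(d - 1). *)
Fixpoint caterpillar (d k n : nat) : rooted :=
  let S := join_copies d.-1 (cayley d k) in
  if n is n'.+1 then attach S (caterpillar d k n') else S.

Lemma cayley_root_degree d k : root_degree (cayley d k) = if k is 0 then 0%N else d.
Proof. by case: k => [|k] /=; rewrite ?degree_single ?join_copies_degree. Qed.

(** From depth two on, some vertex has both d children and a parent. *)
Lemma cayley_max_degree d k : (0 < d)%N -> max_degree (cayley d k.+2) = d.+1.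
Proof.
case: d => // d _; elim: k => [|k IH].
  have E : cayley d.+1 2 = join_copies d.+1 (join_copies d.+1 single) by [].
  by rewrite E !join_copies_degree !degree_single; lia.
have E : cayley d.+1 k.+3 = join_copies d.+1 (cayley d.+1 k.+2) by [].
by rewrite E join_copies_degree IH cayley_root_degree; lia.
Qed.

Lemma caterpillarS d k n : caterpillar d k n.+1 =
  attach (join_copies d.-1 (cayley d k)) (caterpillar d k n).
Proof. by []. Qed.

Lemma caterpillar_degree d k n : (1 < d)%N ->
  max_degree (caterpillar d k.+2 n) = d.+1.
Proof.
case: d => [|[|d]] // _.
have dS : max_degree (join_copies d.+1 (cayley d.+2 k.+2)) = d.+3.
  by rewrite join_copies_degree cayley_max_degree // cayley_root_degree; lia.
have rS : root_degree (join_copies d.+1 (cayley d.+2 k.+2)) = d.+1.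
  by rewrite join_copies_degree.
have rc m : (root_degree (caterpillar d.+2 k.+2 m) <= d.+2)%N.
  case: m => [|m]; last by rewrite caterpillarS root_degree_attach rS.
  by rewrite [root_degree _]rS.
elim: n => [|n IH]; first exact: dS.
rewrite caterpillarS max_degree_attach dS rS IH.
by have := rc n; lia.
Qed.

(** The independence polynomial of a path with n vertices, homogenised: an
    occupied vertex has weight P and an empty one has weight Q. The recursion
    removes an end vertex, together with its neighbour when it is occupied.
    Thus spine m 1 n is the polynomial of the path at activity m. *)
Fixpoint spine (C : comNzRingType) (P Q : C) (n : nat) : C :=
  match n with
  | 0 => 1
  | n'.+1 => match n' with
             | 0 => P + Q
             | n''.+1 => Q * spine P Q n' + P * Q * spine P Q n''
             end
  end.

Lemma spineSS (C : comNzRingType) (P Q : C) n :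
  spine P Q n.+2 = Q * spine P Q n.+1 + P * Q * spine P Q n.
Proof. by []. Qed.

(** The pendant trees at a spine vertex contribute poly_out when that vertex is
    occupied and their full polynomial when it is empty, independently of what
    happens at the other spine vertices. *)
Lemma caterpillar_poly d k n (C : comNzRingType) (x : C) :
  indep_poly (caterpillar d k n) x =
  spine (x * poly_out x (cayley d k) ^+ d.-1)
        (indep_poly (cayley d k) x ^+ d.-1) n.+1.
Proof.
rewrite [indep_poly (cayley d k) x]indep_polyE.
set P := x * _; set Q := _ ^+ d.-1.
have inS : poly_in x (join_copies d.-1 (cayley d k)) = P by rewrite join_copies_polys.
have outS : poly_out x (join_copies d.-1 (cayley d k)) = Q by rewrite join_copies_polys.
have outE m : poly_out x (caterpillar d k m) = Q * spine P Q m.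
  have outES l : poly_out x (caterpillar d k l.+1) =
      Q * (poly_in x (caterpillar d k l) + poly_out x (caterpillar d k l)).
    by rewrite caterpillarS poly_out_attach outS.
  have [] // : poly_out x (caterpillar d k m) = Q * spine P Q m /\
               poly_out x (caterpillar d k m.+1) = Q * spine P Q m.+1.
  elim: m => [|m [IHm IHSm]]; first by rewrite outES /= inS outS mulr1.
  split=> //; rewrite outES IHSm spineSS caterpillarS poly_in_attach.
  by rewrite inS IHm addrC mulrA.
rewrite indep_polyE outE; case: n => [|n]; first by rewrite /= inS mulr1.
by rewrite caterpillarS poly_in_attach inS outE spineSS addrC mulrA.
Qed.

Lemma rmorph_poly_out (C D : comNzRingType) (f : {rmorphism C -> D}) x G :
  f (poly_out x G) = poly_out (f x) G.
Proof. by rewrite rmorph_sum; apply: eq_bigr => I _; rewrite rmorphXn. Qed.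

Lemma rmorph_indep_poly (C D : comNzRingType) (f : {rmorphism C -> D}) x (G : rooted) :
  f (indep_poly G x) = indep_poly G (f x).
Proof. by rewrite rmorph_sum; apply: eq_bigr => I _; rewrite rmorphXn. Qed.

(** * Polynomials with positive real part on a disc *)

(** The modulus as a real number; the norm of R[i] takes complex values. *)
Notation modulus := Normc.normc.

Section Modulus.

Variable R : realType.
Implicit Types (z u v : R[i]) (r : R).

Lemma normE z : `|z| = (modulus z)%:C.
Proof. by case: z. Qed.

Lemma modulus_ge0 z : 0 <= modulus z.
Proof. by rewrite -lecR; apply: le_trans (normr_ge0 z) _; rewrite normE. Qed.

Lemma modulusM u v : modulus (u * v) = modulus u * modulus v.
Proof. exact: Normc.normcM. Qed.

Lemma modulus1 : modulus (1 : R[i]) = 1.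
Proof. exact: Normc.normc1. Qed.

Lemma modulusX z n : modulus (z ^+ n) = modulus z ^+ n.
Proof. by elim: n => [|n IH]; rewrite ?expr0 ?modulus1 // !exprS modulusM IH. Qed.

Lemma modulusV z : modulus z^-1 = (modulus z)^-1.
Proof. exact: Normc.normcV. Qed.

Lemma modulusN z : modulus (- z) = modulus z.
Proof. by apply: complexI; rewrite -!normE normrN. Qed.

Lemma modulus0 : modulus (0 : R[i]) = 0.
Proof. exact: Normc.normc0. Qed.

Lemma modulus_eq0 z : (modulus z == 0) = (z == 0).
Proof.
apply/eqP/eqP => [|->]; [exact: Normc.eq0_normc | exact: modulus0].
Qed.

Lemma modulus_gt0 z : (0 < modulus z) = (z != 0).
Proof. by rewrite lt0r modulus_eq0 modulus_ge0 andbT. Qed.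

Lemma modulusD u v : modulus (u + v) <= modulus u + modulus v.
Proof. by rewrite -lecR rmorphD /= -!normE ler_normD. Qed.

Lemma modulusB u v : modulus u - modulus v <= modulus (u - v).
Proof. by have := modulusD (u - v) v; rewrite subrK; lra. Qed.

Lemma modulusBC u v : modulus (u - v) = modulus (v - u).
Proof. by rewrite -modulusN opprB. Qed.

Lemma modulus_real r : modulus (r%:C) = `|r|.
Proof. by rewrite /= expr0n /= addr0 sqrtr_sqr. Qed.

Lemma modulus_ge0_real r : 0 <= r -> modulus (r%:C) = r.
Proof. by move=> r0; rewrite modulus_real ger0_norm. Qed.

Lemma Re_add u v : complex.Re (u + v) = complex.Re u + complex.Re v.
Proof. by case: u v => [a b] [c d]. Qed.

Lemma Re_opp u : complex.Re (- u) = - complex.Re u.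
Proof. by case: u. Qed.

Lemma Re_scale r u : complex.Re (r%:C * u) = r * complex.Re u.
Proof. by case: u => a b /=; rewrite mul0r subr0. Qed.

Lemma Re_modulus z : `|complex.Re z| <= modulus z.
Proof. by rewrite -lecR -normE normc_ge_Re. Qed.

Lemma sqr_modulus z : modulus z ^+ 2 = complex.Re z ^+ 2 + complex.Im z ^+ 2.
Proof. by case: z => a b /=; rewrite sqr_sqrtr // addr_ge0 ?sqr_ge0. Qed.

Lemma modulus_prod (s : seq R[i]) (F : R[i] -> R[i]) :
  modulus (\prod_(u <- s) F u) = \prod_(u <- s) modulus (F u).
Proof.
elim: s => [|u s IH]; first by rewrite !big_nil modulus1.
by rewrite !big_cons modulusM IH.
Qed.

Lemma poly_bounded (p : {poly R[i]}) r :
  exists2 M, 0 < M & forall z, modulus z <= r -> modulus p.[z] <= M.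
Proof.
elim/poly_ind: p => [|p c [M M0 IH]].
  by exists 1 => // z _; rewrite horner0 modulus0.
exists (M * `|r| + modulus c + 1) => [|z zr].
  by have := modulus_ge0 c; have := mulr_ge0 (ltW M0) (normr_ge0 r); lra.
rewrite hornerMXaddC; apply: le_trans (modulusD _ _) _; rewrite modulusM.
have : modulus p.[z] * modulus z <= M * `|r|.
  by rewrite ler_pM ?modulus_ge0 ?IH // (le_trans zr) ?ler_norm.
lra.
Qed.

Definition zero_free (p : {poly R[i]}) r := forall z, modulus z < r -> p.[z] != 0.

Lemma poly_factor (p : {poly R[i]}) r : zero_free p r ->
  exists2 s : seq R[i], {in s, forall u, r <= modulus u} &
    p = lead_coef p *: \prod_(u <- s) ('X - u%:P).
Proof.
move=> pr; have [s ps] := closed_field_poly_normal p; exists s => // u us.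
rewrite leNgt; apply/negP => /pr; rewrite ps hornerZ mulf_eq0 negb_or => /andP[_].
by rewrite -rootE root_prod_XsubC us.
Qed.

(** Every root u has modulus at least r >= 2 |z|, so each linear factor loses
    at most a factor 2 between 0 and z. The constant depends on the polynomial
    only through its size and its value at 0, which makes the bound uniform in
    families of polynomials of bounded degree. *)
Lemma zero_free_lower (p : {poly R[i]}) r z : zero_free p r -> modulus z <= r / 2 ->
  modulus p.[0] / 2 ^+ size p <= modulus p.[z].
Proof.
move=> pr zr; have [-> | p0] := eqVneq p 0; first by rewrite !horner0 modulus0 mul0r.
have [s sr ps] := poly_factor pr.
have ss : size p = (size s).+1.
  by rewrite ps size_scale ?lead_coef_eq0 // size_prod_XsubC.
rewrite ss {1 2}ps !hornerZ !modulusM -mulrA ler_wpM2l ?modulus_ge0 //.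
rewrite !horner_prod !modulus_prod.
apply: (@le_trans _ _ ((\prod_(u <- s) modulus ('X - u%:P).[0]) / 2 ^+ size s)).
  rewrite ler_wpM2l ?prodr_ge0 // ?modulus_ge0 // => [*|]; first exact: modulus_ge0.
  by rewrite lef_pV2 ?posrE ?exprn_gt0 // ler_weXn2l // ler1n.
elim: s sr {ps ss} => [|u s IH] sr; first by rewrite !big_nil expr0 divr1.
rewrite !big_cons /= exprS invfM mulrACA ler_pM ?mulr_ge0 ?modulus_ge0 ?invr_ge0 //.
- by rewrite prodr_ge0 // => *; rewrite modulus_ge0.
- by rewrite exprn_ge0.
- rewrite !hornerXsubC sub0r modulusN modulusBC.
  have := modulusB u z; have := sr u (mem_head _ _); lra.
- by apply: IH => v vs; apply: sr; rewrite inE vs orbT.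
Qed.

Lemma bernoulli (x : R) n : -1 <= x -> 1 + n%:R * x <= (1 + x) ^+ n.
Proof.
move=> x1; elim: n => [|n IH]; first by rewrite mul0r addr0 expr0.
rewrite exprS -natr1; have : (1 + x) * (1 + n%:R * x) <= (1 + x) * (1 + x) ^+ n.
  by rewrite ler_wpM2l //; lra.
by apply: le_trans; have : 0 <= n%:R * (x * x) :> R; [rewrite mulr_ge0 // -expr2 sqr_ge0 | lra].
Qed.

Lemma geometric_small (q e : R) : 0 <= q -> q < 1 -> 0 < e ->
  exists n0, forall n, (n0 <= n)%N -> q ^+ n <= e.
Proof.
rewrite le_eqVlt => /orP[/eqP <- _ e0|q0 q1 e0].
  by exists 1%N => -[|n] // _; rewrite expr0n ltW.
set h := q^-1 - 1; have h0 : 0 < h by rewrite subr_gt0 invf_gt1.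
have eh : 0 <= e^-1 / h by rewrite divr_ge0 ?invr_ge0 ?(ltW e0) ?(ltW h0).
have := archi_boundP eh.
set n0 := Num.bound _ => hn; exists n0 => n n0n.
have := @bernoulli h n; have -> : 1 + h = q^-1 by rewrite /h; lra.
have hh : e^-1 < n%:R * h.
  by rewrite -ltr_pdivrMr // (lt_le_trans hn) // ler_nat.
have h1 : -1 <= h by lra.
move=> /(_ h1) B; rewrite -[q ^+ n]invrK -[e]invrK lef_pV2 ?posrE ?invr_gt0 ?exprn_gt0 //.
by rewrite -exprVn; lra.
Qed.

(** Linear factors are inverted one at a time by truncated geometric series:
    (z - u) * (- u^-1 * sum_(j < n) (z / u)^j) = 1 - (z / u)^n. *)
Lemma zero_free_inverse (p : {poly R[i]}) r s e : 0 <= r -> r < s -> zero_free p s ->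
  0 < e -> exists q : {poly R[i]}, forall z, modulus z <= r ->
    modulus (q.[z] * p.[z] - 1) <= e.
Proof.
move=> r0 rs ps; have s0 : 0 < s by lra.
have p0 : lead_coef p != 0.
  rewrite lead_coef_eq0; apply: contra (ps 0 _) => [/eqP->|]; first by rewrite horner0.
  by rewrite modulus0.
have [us uss ->] := poly_factor ps.
move: (lead_coef p) p0 => c c0.
suff H e' : 0 < e' -> exists q : {poly R[i]}, forall z, modulus z <= r ->
    modulus (q.[z] * (\prod_(u <- us) ('X - u%:P)).[z] - 1) <= e'.
  move=> /H[q hq]; exists (c^-1 *: q) => z /hq.
  by rewrite !hornerZ mulrACA mulVf // mul1r.
elim: us uss e' => [|u us IH] uss e' e0.
  exists 1 => z _; rewrite big_nil hornerC mul1r subrr modulus0; exact: ltW.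
pose d := Num.min (e' / 3) 1; have d0 : 0 < d by rewrite lt_min divr_gt0 //=; lra.
have de : d <= e' / 3 by rewrite ge_min lexx.
have d1 : d <= 1 by rewrite ge_min lexx orbT.
have [v vus|q hq] := IH _ d d0; first by apply: uss; rewrite inE vus orbT.
have us_u : s <= modulus u by apply: uss; rewrite mem_head.
have u0 : u != 0 by rewrite -modulus_gt0; lra.
have [n0 /(_ n0 (leqnn _)) hn] := geometric_small (divr_ge0 r0 (ltW s0))
  (ltac:(by rewrite ltr_pdivrMr // mul1r) : r / s < 1) d0.
exists ((- u^-1 *: \sum_(j < n0) (u^-1 *: 'X) ^+ j) * q) => z zr.
have -> : ((- u^-1 *: \sum_(j < n0) (u^-1 *: 'X) ^+ j) * q).[z] *
   (\prod_(v <- u :: us) ('X - v%:P)).[z] =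
   (1 - (u^-1 * z) ^+ n0) * (q.[z] * (\prod_(v <- us) ('X - v%:P)).[z]).
  rewrite big_cons !hornerM hornerZ horner_sum hornerXsubC.
  rewrite (eq_bigr (fun j : 'I_n0 => (u^-1 * z) ^+ j)); last first.
    by move=> j _; rewrite horner_exp hornerZ hornerX.
  rewrite -[1 - _]opprB subrX1 -mulNr; set S := \sum_(j < n0) _.
  have -> : - (u^-1 * z - 1) = - u^-1 * (z - u).
    by rewrite mulrBr mulNr (mulNr _ u) mulVf // opprK opprB addrC.
  ring.
have := hq z zr; set w := q.[z] * _.
have hz : modulus ((u^-1 * z) ^+ n0) <= d.
  rewrite modulusX modulusM modulusV; apply: le_trans hn; rewrite lerXn2r ?nnegrE //.
  - by rewrite mulr_ge0 ?invr_ge0 ?modulus_ge0.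
  - by rewrite divr_ge0 // ltW.
  - rewrite mulrC ler_pM ?invr_ge0 ?modulus_ge0 // lef_pV2 // posrE; lra.
set t := (_ * z) ^+ n0 in hz *; move=> hw.
have -> : (1 - t) * w - 1 = (w - 1) - t * (w - 1) - t by ring.
have h1 := modulusD (w - 1 - t * (w - 1)) (- t).
have h2 := modulusD (w - 1) (- (t * (w - 1))).
rewrite !modulusN modulusM in h1 h2.
have h3 : modulus t * modulus (w - 1) <= 1 * d.
  by rewrite ler_pM ?modulus_ge0 // (le_trans hz).
lra.
Qed.

Lemma primitive_root_complex n : exists w : R[i], n.+1.-primitive_root w.
Proof.
pose p : {poly R[i]} := 'X^(n.+1) - 1.
have mp : p \is monic by apply: monicXnsubC.
have [s ps] := closed_field_poly_normal p.
rewrite (monicP mp) scale1r in ps.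
have us : uniq s.
  rewrite -(separable_prod_XsubC s) -ps separable_Xn_sub_1 //.
  by rewrite pnatr_eq0.
have ss : size s = n.+1.
  by have := size_XnsubC (1 : R[i]) (ltn0Sn n); rewrite -/p ps size_prod_XsubC => -[].
have hall : all n.+1.-unity_root s.
  apply/allP => w ws; rewrite /root_of_unity -/p ps root_prod_XsubC //.
have := @has_prim_root _ n.+1 s (ltn0Sn _) hall us; rewrite ss => /(_ (leqnn _)).
by move=> /hasP[w _ hw]; exists w.
Qed.

(** Orthogonality of characters; it replaces integration over a circle. *)
Lemma sum_primitive_root n (w : R[i]) k : n.+1.-primitive_root w ->
  \sum_(j < n.+1) (w ^+ j) ^+ k = if (n.+1 %| k)%N then n.+1%:R else 0.
Proof.
move=> pw; case: ifP => nk.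
  rewrite (eq_bigr (fun=> 1)) ?sumr_const ?card_ord // => j _.
  by rewrite exprAC (_ : w ^+ k = 1) ?expr1n //; apply/eqP; rewrite -(prim_order_dvd pw).
have wk : w ^+ k != 1 by rewrite -(prim_order_dvd pw) nk.
apply: (mulfI (_ : w ^+ k - 1 != 0)); first by rewrite subr_eq0.
rewrite mulr0 (eq_bigr (fun j : 'I_n.+1 => (w ^+ k) ^+ j)); last by move=> j _; rewrite exprAC.
by rewrite -subrX1 exprAC (prim_expr_order pw) expr1n subrr.
Qed.

(** The discrete form of the Cauchy formula for the coefficients: the average
    over the roots of unity, twisted by the power l, keeps the monomials of
    degree congruent to - l. *)
Lemma poly_average n (w : R[i]) (p : {poly R[i]}) (r : R[i]) l :
  n.+1.-primitive_root w -> (size p <= n.+1)%N ->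
  \sum_(j < n.+1) p.[r * w ^+ j] * (w ^+ j) ^+ l =
  n.+1%:R * \sum_(m < n.+1 | (n.+1 %| m + l)%N) p`_m * r ^+ m.
Proof.
move=> pw sp.
rewrite (eq_bigr (fun j : 'I_n.+1 =>
  \sum_(m < n.+1) p`_m * r ^+ m * (w ^+ j) ^+ (m + l))); last first.
  move=> j _; rewrite (horner_coef_wide _ sp) big_distrl /=; apply: eq_bigr => m _.
  by rewrite exprMn exprD; ring.
rewrite exchange_big /= [in RHS]big_mkcond /= mulr_sumr; apply: eq_bigr => m _.
rewrite -big_distrr /= sum_primitive_root //; case: ifP => _; last by rewrite !mulr0.
by rewrite mulrC.
Qed.

(** Average p over the circle of radius r against the nonnegative kernel
    2 + conj(c) w^k + c w^(-k) with |c| = 1. The average is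
    2 p_0 + c p_k r^k, and its real part is nonnegative; c is chosen so
    that c p_k = - |p_k|. *)
Lemma caratheodory (p : {poly R[i]}) r k : 0 < r -> (0 < k)%N ->
  (forall z, modulus z <= r -> 0 <= complex.Re p.[z]) ->
  modulus p`_k * r ^+ k <= 2 * complex.Re p`_0.
Proof.
move=> r0 k0 hp.
have [pk0|pk0] := eqVneq p`_k 0.
  rewrite pk0 modulus0 mul0r mulr_ge0 // -horner_coef0 hp // modulus0; exact: ltW.
(* Enough points for the monomials of p to be separated: none but p`_0 and
   p`_k contributes to the average. *)
pose n := (size p + k)%N.
have [w pw] := primitive_root_complex n.
have sp : (size p <= n.+1)%N by rewrite /n; lia.
have ksp : (k < size p)%N.
  by rewrite ltnNge; apply: contra pk0 => /leq_sizeP ->.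
have wn : modulus w = 1.
  apply/eqP; rewrite -(@pexpr_eq1 _ _ n.+1) ?modulus_ge0 //.
  by rewrite -modulusX (prim_expr_order pw) modulus1.
(* The phase for which c * p`_k = - |p`_k|. *)
pose c := - ((modulus p`_k)%:C / p`_k).
have cn : modulus c = 1.
  rewrite modulusN modulusM modulusV modulus_ge0_real ?modulus_ge0 // divff //.
  by rewrite modulus_eq0.
have avg l := poly_average r%:C l pw sp.
pose K j : R[i] := 2 + (c^*%C * (w ^+ j) ^+ k + c * (w ^+ j) ^+ (n.+1 - k)).
have Kreal j : exists2 t : R, 0 <= t & K j = t%:C.
  exists (2 + 2 * complex.Re (c^*%C * (w ^+ j) ^+ k)).
    have := Re_modulus (c^*%C * (w ^+ j) ^+ k).
    rewrite modulusM !modulusX wn !expr1n mulr1.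
    have -> : modulus c^*%C = 1 by apply: complexI; rewrite -normE normcJ normE cn.
    rewrite ler_norml; lra.
  rewrite /K rmorphD rmorphM /= -[(2%R)%:C]/(real_complex R 2) !rmorph_nat -addcJ.
  congr (_ + (_ + _)).
  rewrite rmorphM /= conjcK; congr (c * _).
  have kn : (k <= n.+1)%N by rewrite /n; lia.
  have u1 : (w ^+ j) ^+ k * ((w ^+ j) ^+ k)^*%C = 1.
    by rewrite -sqr_normc normE !modulusX wn !expr1n.
  have u0 : (w ^+ j) ^+ k != 0.
    by apply/eqP => u0; move/eqP: u1; rewrite u0 mul0r eq_sym oner_eq0.
  apply: (mulfI u0); rewrite u1 -exprD subnKC //.
  by rewrite exprAC (prim_expr_order pw) expr1n.
have pos : 0 <= complex.Re (\sum_(j < n.+1) p.[r%:C * w ^+ j] * K j).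
  elim/big_ind: _ => // [x y hx hy|j _]; first by rewrite Re_add addr_ge0.
  have [t t0 ->] := Kreal j; rewrite mulrC Re_scale mulr_ge0 // hp //.
  by rewrite modulusM modulusX wn expr1n mulr1 modulus_ge0_real // ltW.
have sumE : \sum_(j < n.+1) p.[r%:C * w ^+ j] * K j =
    n.+1%:R * (2 * p`_0 + c * (p`_k * r%:C ^+ k)).
  rewrite (eq_bigr (fun j : 'I_n.+1 => 2 * (p.[r%:C * w ^+ j] * (w ^+ j) ^+ 0) +
    (c^*%C * (p.[r%:C * w ^+ j] * (w ^+ j) ^+ k) +
     c * (p.[r%:C * w ^+ j] * (w ^+ j) ^+ (n.+1 - k))))); last first.
    by move=> j _; rewrite /K expr0; ring.
  rewrite !big_split -!mulr_sumr !avg /=.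
  rewrite (big_pred1 (ord0 : 'I_n.+1)); last first.
    move=> m; rewrite addn0 /= -val_eqE /=; case: (posnP m) => [->|m0]; first by rewrite dvdn0.
    rewrite gtnNdvd // ?ltn_ord //; lia.
  rewrite [X in c^*%C * (_ * X)]big1 => [|m hm]; last first.
    have [mp|mp] := ltnP m (size p); last by rewrite (leq_sizeP _ _ (leqnn _)) ?mul0r.
    by have := dvdn_leq (ltn_addl m k0) hm; rewrite /n ltn_add2r ltnNge (ltnW mp).
  have kn : (k < n.+1)%N by rewrite /n; lia.
  rewrite (bigD1 (Ordinal kn)) /=; last by rewrite subnKC // ltnW.
  rewrite [X in c * (_ * (_ + X))]big1 => [|m /andP[hm mk]]; last first.
    have /eqP mk' : (m != k :> nat) by [].
    case/dvdnP: hm => -[|[|q]] hq; try lia.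
    by have := ltn_ord m; nia.
  by rewrite expr0; ring.
move: pos; rewrite sumE -[n.+1%:R](rmorph_nat (real_complex R)) Re_scale pmulr_rge0 ?ltr0n //.
rewrite -[2](rmorph_nat (real_complex R)) Re_add Re_scale.
have -> : c * (p`_k * r%:C ^+ k) = (- (modulus p`_k * r ^+ k))%:C.
  rewrite rmorphN rmorphM rmorphXn /= /c mulNr mulrA divfK //.
rewrite [X in _ + X]/=; lra.
Qed.

Lemma modulus_sum (I : finType) (F : I -> R[i]) :
  modulus (\sum_i F i) <= \sum_i modulus (F i).
Proof.
elim/big_ind2: _ => [|x1 x2 y1 y2 h1 h2|//]; first by rewrite modulus0.
by apply: le_trans (modulusD _ _) _; rewrite lerD.
Qed.

Lemma geometric_sum_le2 (t : R) n : 0 <= t -> t <= 1 / 2 -> \sum_(i < n) t ^+ i <= 2.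
Proof.
move=> t0 t1; have := subrX1 t n; set S := \sum_(i < n) _ => hS.
have S0 : 0 <= S by rewrite sumr_ge0 // => i _; rewrite exprn_ge0.
have tn : 0 <= t ^+ n by rewrite exprn_ge0.
nra.
Qed.

(** Sum the coefficient bounds of [caratheodory] as a geometric series. *)
Lemma harnack_poly (p : {poly R[i]}) r z : 0 < r ->
  (forall u, modulus u <= r -> 0 <= complex.Re p.[u]) -> modulus z <= r / 2 ->
  modulus (p.[z] - p.[0]) <= 4 * complex.Re p.[0] * (modulus z / r).
Proof.
move=> r0 hp zr; rewrite horner_coef0 horner_coef.
have t0 : 0 <= modulus z / r by rewrite divr_ge0 ?modulus_ge0 // ltW.
have t1 : modulus z / r <= 1 / 2 by rewrite ler_pdivrMr //; lra.
have pr0 : 0 <= complex.Re p`_0.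
  by rewrite -horner_coef0 hp // modulus0 ltW.
case sp: (size p) => [|n].
  by rewrite big_ord0 nth_default ?sp // subrr modulus0 mulr0 mul0r.
rewrite big_ord_recl /= expr0 mulr1 addrC addKr.
apply: le_trans (modulus_sum _) _.
apply: (@le_trans _ _ (\sum_(i < n) 2 * complex.Re p`_0 * (modulus z / r) * (modulus z / r) ^+ i)).
  apply: ler_sum => i _; rewrite modulusM modulusX /bump /= add1n.
  rewrite -[X in _ <= X]mulrA -exprS.
  have {1}-> : modulus z = r * (modulus z / r) by rewrite mulrC divfK ?lt0r_neq0.
  rewrite exprMn mulrA ler_wpM2r ?exprn_ge0 //; exact: caratheodory.
rewrite -mulr_sumr; have := geometric_sum_le2 n t0 t1; set S := \sum_(i < n) _ => hS.
have : 0 <= 2 * complex.Re p`_0 * (modulus z / r).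
  by rewrite mulr_ge0 // mulr_ge0.
nra.
Qed.

(** The rational function is a uniform limit of polynomials by
    [zero_free_inverse]; shifting the approximants by a small constant restores
    the sign of their real parts. *)
Lemma harnack (A B : {poly R[i]}) r z : 0 < r -> zero_free B (2 * r) ->
  (forall u, modulus u <= r -> 0 <= complex.Re (A.[u] / B.[u])) -> modulus z <= r / 2 ->
  modulus (A.[z] / B.[z] - A.[0] / B.[0]) <=
    4 * complex.Re (A.[0] / B.[0]) * (modulus z / r).
Proof.
move=> r0 hB hAB zr; apply/ler_addgt0Pr => e e0.
have [MA MA0 hA] := poly_bounded A r.
have B0 : 0 < modulus B.[0] / 2 ^+ size B.
  rewrite divr_gt0 ?exprn_gt0 // modulus_gt0 hB // modulus0; lra.
have hBl u : modulus u <= r -> modulus B.[0] / 2 ^+ size B <= modulus B.[u].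
  by move=> ur; apply: zero_free_lower hB _; lra.
set b := (modulus B.[0] / _) in B0 hBl.
pose d := e / 10; have d0 : 0 < d by rewrite divr_gt0.
have [q hq] := zero_free_inverse (ltW r0) (ltac:(lra) : r < 2 * r) hB
  (mulr_gt0 d0 (divr_gt0 B0 MA0)).
have app u : modulus u <= r -> modulus ((A * q).[u] - A.[u] / B.[u]) <= d.
  move=> ur; have hb := hBl u ur.
  have Bu : B.[u] != 0 by rewrite -modulus_gt0; lra.
  have -> : (A * q).[u] - A.[u] / B.[u] = A.[u] / B.[u] * (q.[u] * B.[u] - 1).
    by rewrite hornerM; field.
  rewrite !modulusM modulusV.
  have h : modulus A.[u] / modulus B.[u] <= MA / b.
    rewrite ler_pM ?invr_ge0 ?modulus_ge0 ?hA // lef_pV2 ?posrE //; lra.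
  apply: (@le_trans _ _ (MA / b * (d * (b / MA)))).
    by rewrite ler_pM ?mulr_ge0 ?invr_ge0 ?modulus_ge0 ?hq.
  have b0 : b != 0 by rewrite lt0r_neq0.
  have M0 : MA != 0 by rewrite lt0r_neq0.
  by rewrite (_ : MA / b * (d * (b / MA)) = d) //; field; rewrite b0 M0.
(* The shift by d compensates the error of the approximation. *)
pose p := A * q + (d%:C)%:P.
have pE u : p.[u] = (A * q).[u] + d%:C by rewrite /p hornerD hornerC.
have hp u : modulus u <= r -> 0 <= complex.Re p.[u].
  move=> ur; have := app u ur; have := hAB u ur.
  have := Re_modulus ((A * q).[u] - A.[u] / B.[u]).
  rewrite pE !Re_add Re_opp [complex.Re d%:C]/= ler_norml => /andP[]; lra.
have := harnack_poly r0 hp zr.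
have a0 : modulus 0 <= r by rewrite modulus0 ltW.
have za : modulus z <= r by lra.
have hz := app z za; have h0 := app 0 a0.
have t0 : 0 <= modulus z / r by rewrite divr_ge0 ?modulus_ge0 // ltW.
have t1 : modulus z / r <= 1 / 2 by rewrite ler_pdivrMr //; lra.
rewrite !pE; set t := modulus z / r in t0 t1 *.
have := Re_modulus ((A * q).[0] - A.[0] / B.[0]).
rewrite Re_add !Re_add Re_opp [complex.Re d%:C]/= ler_norml => /andP[_ hr].
have -> : (A * q).[z] + d%:C - ((A * q).[0] + d%:C) =
  (A.[z] / B.[z] - A.[0] / B.[0]) +
  (((A * q).[z] - A.[z] / B.[z]) - ((A * q).[0] - A.[0] / B.[0])) by ring.
set X := A.[z] / B.[z] - A.[0] / B.[0]; set Y := (_ - _ - _) => hX.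
have hY : modulus Y <= d + d.
  by apply: le_trans (modulusD _ _) _; rewrite modulusN; lra.
have hXY := modulusD (X + Y) (- Y); rewrite addrK modulusN in hXY.
have hR := hAB 0 a0.
have de : e = 10 * d by rewrite /d; lra.
nra.
Qed.

End Modulus.

(** * Path polynomials off the critical ray *)

(** Dividing all weights by Q turns the spine into a path at activity P / Q. *)
Lemma spine_homog (C : comNzRingType) (m Q : C) n :
  spine (Q * m) Q n = Q ^+ n * spine m 1 n.
Proof.
have [] // : spine (Q * m) Q n = Q ^+ n * spine m 1 n /\
             spine (Q * m) Q n.+1 = Q ^+ n.+1 * spine m 1 n.+1.
elim: n => [|n [IH IHS]]; first by rewrite /= expr0 expr1; split; ring.
by split=> //; rewrite !spineSS IH IHS !exprS; ring.
Qed.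

Lemma rmorph_spine (C D : comNzRingType) (f : {rmorphism C -> D}) P Q n :
  f (spine P Q n) = spine (f P) (f Q) n.
Proof.
have [] // : f (spine P Q n) = spine (f P) (f Q) n /\
             f (spine P Q n.+1) = spine (f P) (f Q) n.+1.
elim: n => [|n [IH IHS]]; first by rewrite /= rmorph1 rmorphD.
by split=> //; rewrite !spineSS rmorphD !rmorphM /= IH IHS.
Qed.

Section Slit.
Variable R : realType.

(** Closed form of the path recursion, whose characteristic equation
    X^2 = X + m has the roots a and b. *)
Lemma spine_binet (m a b : R[i]) n : a + b = 1 -> a * b = - m ->
  (a - b) * spine m 1 n = a ^+ n.+2 - b ^+ n.+2.
Proof.
move=> ab1 abm; have -> : m = - (a * b) by rewrite abm opprK.
have {ab1 abm} -> : b = 1 - a by rewrite -ab1 addrC addKr.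
set c := 1 - a.
have [] // : (a - c) * spine (- (a * c)) 1 n = a ^+ n.+2 - c ^+ n.+2 /\
   (a - c) * spine (- (a * c)) 1 n.+1 = a ^+ n.+3 - c ^+ n.+3.
elim: n => [|n [IH IHS]]; first by rewrite /= /c !exprS expr0; split; ring.
split=> //; rewrite spineSS mulrDr mulrCA mul1r IHS mulr1 mulrCA IH.
by rewrite /c !exprS; ring.
Qed.

(** Let h be the root of 1 + 4 u with Re h >= 0 and let a, b = (1 +- h) / 2.
    By [spine_binet], the ratio differs from a by h w / (1 - w), where
    w = (b / a)^(n + 2). Distance m from the ray bounds Re h from below, and
    |a|^2 - |b|^2 = Re h, so |b / a| stays away from 1 and w tends to 0
    uniformly in u. Since Re a >= 1/2, the real part becomes nonnegative. *)
Lemma spine_slit (m M : R) : 0 < m ->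
  exists n0, forall n, (n0 <= n)%N -> forall u : R[i],
    (forall t : R, 1 / 4 <= t -> m <= modulus (u + t%:C)) -> modulus u <= M ->
    0 <= complex.Re (spine u 1 n.+1 / spine u 1 n).
Proof.
move=> m0.
(* H bounds |h| and |a|, d bounds Re h from below, and w is small once
   |w| <= e. *)
pose H := 2 + 4 * `|M|; pose d := 2 * m / H; pose e := (2 * H + 1)^-1.
have H2 : 2 <= H by rewrite /H; have := normr_ge0 M; lra.
have d0 : 0 < d by rewrite divr_gt0 //; lra.
have e0 : 0 < e by rewrite invr_gt0; lra.
pose q := Num.max 0 (1 - d / H ^+ 2).
have H20 : 0 < H ^+ 2 by rewrite exprn_gt0 //; lra.
have [n0 hn0] : exists n0, forall n, (n0 <= n)%N -> q ^+ n <= e ^+ 2.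
  apply: geometric_small; rewrite ?exprn_gt0 // /q; first by rewrite le_max lexx.
  by rewrite gt_max ltr01 /=; have := divr_gt0 d0 H20; lra.
exists n0 => n n0n u hu uM.
have [h hh hx] : exists2 h : R[i], h ^+ 2 = 1 + 4 * u & 0 <= complex.Re h.
  have [hx|hx] := leP 0 (complex.Re (sqrtc (1 + 4 * u))).
    by exists (sqrtc (1 + 4 * u)); rewrite ?sqr_sqrtc.
  by exists (- sqrtc (1 + 4 * u)); rewrite ?sqrrN ?sqr_sqrtc // Re_opp; lra.
have modn k : modulus (k%:R : R[i]) = k%:R.
  by rewrite -(rmorph_nat (real_complex R)) modulus_ge0_real.
set x := complex.Re h in hx; pose y := complex.Im h.
have hE : h = x +i* y by rewrite /x /y; case: (h).
have hH : modulus h <= H.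
  have : modulus h ^+ 2 <= 1 + 4 * M.
    rewrite -modulusX hh; apply: le_trans (modulusD _ _) _.
    by rewrite modulus1 modulusM modn; lra.
  have := modulus_ge0 h; have := ler_norm M; rewrite /H; nra.
have dx : d <= x.
  (* The point of the ray with the same imaginary part of the square root: here
     u + t = x (x + 2 i y) / 4. *)
  have /hu : 1 / 4 <= (1 + y ^+ 2) / 4 by have := sqr_ge0 y; lra.
  have -> : u + ((1 + y ^+ 2) / 4)%:C = (1 / 4)%:C * (x%:C * (x +i* (2 * y))).
    have -> : u = (h ^+ 2 - 1) / 4 by rewrite hh; field.
    rewrite [h]complexE [x +i* _]complexE -/x -/y [complex.Re _]/= [complex.Im _]/=.
    have -> : (x%:C + 'i%C * y%:C) ^+ 2 =
        x%:C ^+ 2 + 2 * x%:C * 'i%C * y%:C + ('i%C) ^+ 2 * y%:C ^+ 2 by ring.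
    rewrite sqr_i !(fmorph_div, rmorphM, rmorphD, rmorphXn, rmorph1, rmorph_nat) /=.
    by field.
  rewrite !modulusM !modulus_ge0_real //; last by lra.
  have : modulus (x +i* (2 * y)) <= 2 * modulus h.
    rewrite -ler_sqr ?nnegrE ?mulr_ge0 ?modulus_ge0 // exprMn !sqr_modulus hE /=.
    have := sqr_ge0 x; lra.
  move=> h1 h2; rewrite ler_pdivrMr; last by lra.
  have := modulus_ge0 (x +i* (2 * y)).
  have : x * modulus (x +i* (2 * y)) <= x * (2 * H) by rewrite ler_wpM2l //; lra.
  lra.
pose a := (1 + h) / 2; pose b := (1 - h) / 2.
have ab1 : a + b = 1 by rewrite /a /b; field.
have abm : a * b = - u.
  have -> : a * b = (1 - h ^+ 2) / 4 by rewrite /a /b; field.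
  by rewrite hh; field.
have abh : a - b = h by rewrite /a /b; field.
have Sn k : h * spine u 1 k = a ^+ k.+2 - b ^+ k.+2.
  by rewrite -abh; exact: spine_binet.
have sab : modulus a ^+ 2 - modulus b ^+ 2 = x.
  rewrite !modulusM modulusV modn !exprMn !sqr_modulus hE /=; by field.
have aH : modulus a <= H.
  rewrite modulusM modulusV modn.
  by have := modulusD 1 h; rewrite modulus1; lra.
have a2 : 0 < modulus a ^+ 2 by have := sqr_ge0 (modulus b); lra.
have a0 : a != 0 by rewrite -modulus_gt0 lt0r modulus_ge0 andbT; apply: contraTneq a2 => ->; rewrite expr0n ltxx.
pose zt := b / a.
have ztq : modulus zt ^+ 2 <= q.
  rewrite /zt modulusM modulusV expr_div_n /q le_max; apply/orP; right.
  rewrite ler_pdivrMr //.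
  have aH2 : modulus a ^+ 2 <= H ^+ 2 by rewrite ler_sqr ?nnegrE ?modulus_ge0 //; lra.
  have : d / H ^+ 2 * modulus a ^+ 2 <= d.
    rewrite -mulrA ler_piMr ?(ltW d0) // mulrC ler_pdivrMr //; lra.
  lra.
have ztn : modulus (zt ^+ n.+2) <= e.
  rewrite modulusX -ler_sqr ?nnegrE ?exprn_ge0 ?modulus_ge0 //; last exact: ltW.
  rewrite exprAC; apply: le_trans (hn0 n.+2 (leqW (leqW n0n))).
  by rewrite lerXn2r ?nnegrE ?sqr_ge0 // (le_trans _ ztq) ?sqr_ge0.
have bE : b = zt * a by rewrite /zt divfK.
have eH : e * (2 * H + 1) = 1 by rewrite mulVf //; apply/eqP; lra.
have e1 : e < 1 by nra.
set w := zt ^+ n.+2 in ztn.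
have w1 : 1 - w != 0.
  rewrite -modulus_gt0; have := modulusB 1 w; rewrite modulus1; lra.
have h0 : h != 0.
  by apply/eqP => h0; move: dx; rewrite /x h0 /=; lra.
have an0 : a ^+ n.+2 != 0 by rewrite expf_neq0.
have FE : spine u 1 n.+1 / spine u 1 n = a + h * (w / (1 - w)).
  have -> : spine u 1 n.+1 / spine u 1 n =
      (h * spine u 1 n.+1) / (h * spine u 1 n).
    by rewrite invfM mulrACA divff // mul1r.
  rewrite !Sn bE !(exprMn _ zt) (exprS zt n.+2) (exprS a n.+2) -/w -abh bE.
  by field; rewrite w1 -{1}[a ^+ n.+2]mul1r -mulrBl mulf_neq0.
rewrite FE Re_add.
have := Re_modulus (h * (w / (1 - w))); rewrite (modulusM h) (modulusM w) modulusV.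
have hw1 : 1 - e <= modulus (1 - w) by have := modulusB 1 w; rewrite modulus1; lra.
have : modulus h * (modulus w / modulus (1 - w)) <= 1 / 2.
  rewrite mulrA ler_pdivrMr; last by lra.
  have : modulus h * modulus w <= H * e by rewrite ler_pM ?modulus_ge0.
  lra.
have -> : complex.Re a = (1 + x) / 2.
  have -> : a = (1 / 2)%:C * (1%:C + h).
    by rewrite fmorph_div rmorph1 rmorph_nat /a; field.
  by rewrite Re_scale Re_add -/x [complex.Re _]/=; lra.
by rewrite ler_norml => h1 /andP[h2 _]; lra.
Qed.
End Slit.

(** * Zeros of path polynomials *)

Section Trig.
Variable R : realType.

(** For m = - 1 / (4 cos^2 x) the characteristic roots are exp(+- i x) / (2 cos x),
    so the closed form becomes a quotient of sines. *)
Lemma spine_trig (x : R) n : cos x != 0 ->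
  spine (- (1 / (4 * cos x ^+ 2))) 1 n * (2 * cos x) ^+ n.+1 * sin x =
  sin (n.+2%:R * x).
Proof.
move=> c0; set t := 1 / _.
have tc : t * (2 * cos x) ^+ 2 = 1 by rewrite /t; field.
have rec k : sin (k.+2%:R * x) = 2 * cos x * sin (k.+1%:R * x) - sin (k%:R * x).
  have -> : k.+2%:R * x = k.+1%:R * x + x by rewrite -[k.+2]addn1 natrD mulrDl mul1r.
  have -> : k%:R * x = k.+1%:R * x - x by rewrite -[k.+1]addn1 natrD mulrDl mul1r addrK.
  by rewrite sinD sinB; ring.
have [] // : spine (- t) 1 n * (2 * cos x) ^+ n.+1 * sin x = sin (n.+2%:R * x) /\
  spine (- t) 1 n.+1 * (2 * cos x) ^+ n.+2 * sin x = sin (n.+3%:R * x).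
have s2 : sin (2 * x) = 2 * cos x * sin x.
  by rewrite (rec 0%N) mul1r mul0r sin0 subr0.
elim: n => [|n [IH IHS]].
  rewrite (rec 1%N) s2 mul1r /= mul1r expr1; split=> //.
  have -> : (- t + 1) * (2 * cos x) ^+ 2 * sin x =
     (2 * cos x) ^+ 2 * sin x - (t * (2 * cos x) ^+ 2) * sin x by ring.
  by rewrite tc; ring.
split=> //; rewrite rec -IH -IHS spineSS.
have -> : (2 * cos x) ^+ n.+3 = (2 * cos x) ^+ 2 * (2 * cos x) ^+ n.+1 by rewrite -exprD.
have -> : (2 * cos x) ^+ n.+2 = (2 * cos x) * (2 * cos x) ^+ n.+1 by rewrite -exprS.
set U := spine _ _ n.+1; set V := spine _ _ n; set E := (2 * cos x) ^+ n.+1.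
have -> : (1 * U + - t * 1 * V) * ((2 * cos x) ^+ 2 * E) * sin x =
  U * (2 * cos x) ^+ 2 * E * sin x - t * (2 * cos x) ^+ 2 * V * E * sin x by ring.
by rewrite tc; ring.
Qed.

Lemma sin_natpi k : sin (k%:R * pi) = 0 :> R.
Proof.
elim: k => [|k IH]; first by rewrite mul0r sin0.
by rewrite -natr1 mulrDl mul1r sinDpi IH oppr0.
Qed.

(** Write t = 1 / (4 cos^2 x0) and approximate x0 by rational multiples of pi,
    at which the sine in [spine_trig] vanishes. *)
Lemma spine_zeros_dense (t e : R) : 1 / 4 <= t -> 0 < e ->
  exists n, exists2 u : R, 1 / 4 <= u /\ `|u - t| <= e & spine (- u) 1 n = 0.
Proof.
move=> t4 e0.
have st0 : 0 < Num.sqrt t by rewrite sqrtr_gt0; lra.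
have st : Num.sqrt t ^+ 2 = t by rewrite sqr_sqrtr //; lra.
have st2 : 1 / 2 <= Num.sqrt t by nra.
pose c0 := (2 * Num.sqrt t)^-1.
have c00 : 0 < c0 by rewrite invr_gt0; lra.
have c01 : c0 <= 1 by rewrite invf_le1; lra.
have c0I : -1 <= c0 <= 1 by apply/andP; split; lra.
pose x0 := acos c0.
have cx0 : cos x0 = c0 by rewrite acosK // in_itv /= c0I.
have x00 : 0 <= x0 by apply: acos_ge0.
have pi0 := pi_gt0 R.
have x0p : x0 < pi / 2.
  rewrite ltNge; apply/negP => hx.
  have := cosDpihalf (x0 - pi / 2); rewrite subrK cx0.
  have : 0 <= sin (x0 - pi / 2).
    by apply: sin_ge0_pi; have := acos_lepi c0I; rewrite -/x0; lra.
  lra.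
pose f (x : R) := (4 * cos x ^+ 2)^-1.
have fx0 : f x0 = t.
  rewrite /f cx0 /c0 exprVn exprMn st; field.
  by rewrite gt_eqF //; lra.
have cf : (f x @[x --> x0] --> f x0)%classic.
  apply: cvgV; first by rewrite gt_eqF // cx0 mulr_gt0 // exprn_gt0.
  apply: cvgM; first exact: cvg_cst.
  exact: (continuous_comp (@continuous_cos R x0) (@exprn_continuous R 2 (cos x0))).
have /cvgrPdist_le /(_ e e0) := cf; rewrite near_nbhs => /nbhs_ballP[d /= d0 hd].
pose d' := Num.min d (pi / 2 - x0).
have d'0 : 0 < d' by rewrite lt_min d0 /=; lra.
have := archi_boundP (ltW (divr_gt0 pi0 d'0)); set B := Num.bound _ => hB.
have N0 : 0 < B.+2%:R :> R by [].
have hN : pi / B.+2%:R < d'.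
  rewrite ltr_pdivrMr // -ltr_pdivrMl // mulrC (lt_trans hB) // ltr_nat.
  exact: leqnSn.
have kx0 : 0 <= x0 * B.+2%:R / pi by rewrite divr_ge0 ?mulr_ge0 // ltW.
have /andP[k1 k2] := truncn_itv kx0.
pose k := (Num.truncn (x0 * B.+2%:R / pi)).+1; pose x := k%:R * pi / B.+2%:R : R.
have x0x : x0 < x.
  by rewrite /x ltr_pdivlMr // -ltr_pdivrMr.
have xd : x < x0 + d'.
  have : x <= x0 + pi / B.+2%:R.
    rewrite /x ler_pdivrMr // mulrDl divfK ?gt_eqF // /k -natr1 mulrDl mul1r lerD2r.
    by rewrite -ler_pdivlMr.
  by move=> h; apply: le_lt_trans h _; rewrite ltrD2l.
have [xd1 xd2] : x < x0 + d /\ x < pi / 2.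
  have h1 : d' <= d by rewrite ge_min lexx.
  have h2 : d' <= pi / 2 - x0 by rewrite ge_min lexx orbT.
  by split; lra.
have cx : 0 < cos x by apply: cos_gt0_pihalf; apply/andP; split; lra.
have sx : 0 < sin x by apply: sin_gt0_pihalf; apply/andP; split; lra.
have c2 : cos x ^+ 2 <= 1 by have := cos2Dsin2 x; have := sqr_ge0 (sin x); lra.
exists B; exists (1 / (4 * cos x ^+ 2)).
  split.
    have c20 : 0 < cos x ^+ 2 by rewrite exprn_gt0.
    rewrite !mul1r lef_pV2 ?posrE //; lra.
  rewrite mul1r distrC -fx0; apply: hd.
  by rewrite /ball /= ltr_norml; apply/andP; split; lra.
have := spine_trig B (lt0r_neq0 cx).
have -> : B.+2%:R * x = k%:R * pi by rewrite /x mulrC divfK // gt_eqF.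
rewrite sin_natpi -mulrA => /eqP; rewrite mulf_eq0 => /orP[/eqP //|].
by rewrite gt_eqF // mulr_gt0 // exprn_gt0 // mulr_gt0.
Qed.
End Trig.

(** * Lipschitz bounds from absence of zeros *)

Lemma spine_ratio_homog (F : fieldType) (P Q : F) n : Q != 0 ->
  spine P Q n.+1 / (Q * spine P Q n) = spine (P / Q) 1 n.+1 / spine (P / Q) 1 n.
Proof.
move=> Q0; have {1 2}-> : P = Q * (P / Q) by rewrite mulrC divfK.
by rewrite !spine_homog mulrA -exprS invfM mulrACA divff ?expf_neq0 // mul1r.
Qed.

Section Weight.
Variable R : realType.

Section ZeroFree.
Variables (P Q : {poly R[i]}) (s p0 q0 : R).
Hypotheses (p00 : 0 < p0) (q00 : 0 < q0).
Hypotheses (P0 : P.[0] = p0%:C) (Q0 : Q.[0] = q0%:C).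
Hypotheses (Qfree : zero_free Q s) (Sfree : forall n, zero_free (spine P Q n) s).

Lemma spine_horner z n : (spine P Q n).[z] = spine P.[z] Q.[z] n.
Proof. exact: (rmorph_spine (horner_eval z)). Qed.

(** At a zero of the pencil P = - t Q, so the spine polynomial vanishes there by
    homogeneity. *)
Lemma zero_free_pencil n (t : R) : spine (- t) 1 n = 0 -> zero_free (P + t%:C *: Q) s.
Proof.
move=> tn z zs; apply: contra (Sfree n zs) => /eqP; rewrite hornerD hornerZ => /eqP.
rewrite addr_eq0 => /eqP Pz; rewrite spine_horner Pz mulrC -mulrN spine_homog.
have -> : spine (- t%:C) 1 n = (spine (- t) 1 n)%:C.
  by rewrite (rmorph_spine (real_complex R)) /= rmorphN rmorph1.
by rewrite tn mulr0.
Qed.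

(** For t in the dense set of [spine_zeros_dense] the pencil has no zeros and
    [zero_free_lower] applies with a constant independent of t; the bound passes
    to all t by continuity. *)
Lemma pencil_lower (t : R) z : 1 / 4 <= t -> modulus z <= s / 2 ->
  p0 / 2 ^+ maxn (size P) (size Q) <= modulus (P.[z] + t%:C * Q.[z]).
Proof.
move=> t4 zs; apply/ler_addgt0Pr => e e0.
have [M M0 hM] := poly_bounded Q (s / 2).
have [n [u [u4 ut] un]] := spine_zeros_dense t4 (divr_gt0 e0 M0).
have := zero_free_lower (zero_free_pencil un) zs.
rewrite !hornerD !hornerZ P0 Q0 -rmorphM -rmorphD modulus_ge0_real; last first.
  by rewrite addr_ge0 ?mulr_ge0 // ?ltW //; lra.
have -> : P.[z] + u%:C * Q.[z] = (P.[z] + t%:C * Q.[z]) + (u - t)%:C * Q.[z].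
  by rewrite rmorphB /=; ring.
have := modulusD (P.[z] + t%:C * Q.[z]) ((u - t)%:C * Q.[z]).
rewrite modulusM modulus_real.
have h1 : `|u - t| * modulus Q.[z] <= e.
  rewrite -[X in _ <= X](divfK (lt0r_neq0 M0)).
  by rewrite ler_pM ?modulus_ge0 ?hM.
have : p0 / 2 ^+ maxn (size P) (size Q) <= (p0 + u * q0) / 2 ^+ size (P + u%:C *: Q).
  rewrite ler_pM ?invr_ge0 ?exprn_ge0 ?(ltW p00) //.
    by have : 0 <= u * q0 by [rewrite mulr_ge0 // ?ltW //; lra]; lra.
  rewrite lef_pV2 ?posrE ?exprn_gt0 // ler_weXn2l ?ler1n //.
  apply: leq_trans (size_polyD _ _) _.
  by rewrite geq_max leq_maxl /= (leq_trans (size_scale_leq _ _)) ?leq_maxr.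
move=> h2 hD h3; apply: (le_trans h2 (le_trans h3 (le_trans hD _))).
by rewrite lerD2l.
Qed.

(** The quotient P / Q is bounded and, by [pencil_lower], bounded away from the
    ray, so [spine_slit] holds with one n for the whole disc. *)
Lemma spine_ratio_Re : exists n0, forall n, (n0 <= n)%N -> forall z, modulus z <= s / 2 ->
  0 <= complex.Re ((spine P Q n.+1).[z] / (Q * spine P Q n).[z]).
Proof.
have [MQ MQ0 hMQ] := poly_bounded Q (s / 2).
have [MP MP0 hMP] := poly_bounded P (s / 2).
set m := p0 / 2 ^+ maxn (size P) (size Q).
have m0 : 0 < m by rewrite divr_gt0 ?exprn_gt0.
have b0 : 0 < modulus Q.[0] / 2 ^+ size Q.
  by rewrite Q0 modulus_ge0_real ?(ltW q00) // divr_gt0 ?exprn_gt0.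
have [n0 hn] := spine_slit (MP / (modulus Q.[0] / 2 ^+ size Q)) (divr_gt0 m0 MQ0).
exists n0 => n n0n z zs.
have hQ := zero_free_lower Qfree zs.
have Qz : Q.[z] != 0 by rewrite -modulus_gt0; lra.
have -> : (spine P Q n.+1).[z] / (Q * spine P Q n).[z] =
    spine (P.[z] / Q.[z]) 1 n.+1 / spine (P.[z] / Q.[z]) 1 n.
  by rewrite hornerM !spine_horner spine_ratio_homog.
apply: hn => // [t t4|].
  have -> : P.[z] / Q.[z] + t%:C = (P.[z] + t%:C * Q.[z]) / Q.[z] by field.
  rewrite modulusM modulusV ler_pM ?invr_ge0 ?(ltW m0) ?(ltW MQ0) //.
    exact: pencil_lower.
  rewrite lef_pV2 ?posrE ?hMQ //; lra.
rewrite modulusM modulusV ler_pM ?invr_ge0 ?modulus_ge0 ?hMP //.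
rewrite lef_pV2 ?posrE //; lra.
Qed.

End ZeroFree.

Lemma spine_real_bounds (u : R) n : 0 <= u ->
  [/\ 0 < spine u 1 n, spine u 1 n <= spine u 1 n.+1 &
      spine u 1 n.+1 <= (1 + u) * spine u 1 n].
Proof.
move=> u0; elim: n => [|n [h1 h2 h3]]; first by rewrite /=; split; lra.
rewrite !spineSS mul1r mulr1.
have : 0 <= u * spine u 1 n by rewrite mulr_ge0 // ltW.
have : 0 <= u * (spine u 1 n.+1 - spine u 1 n) by rewrite mulr_ge0 // subr_ge0.
by split; lra.
Qed.

(** If F and G are the ratios of consecutive path polynomials for n and n + 1,
    then the activity is F * (G - 1). Both ratios lie between 1 and 1 + M on the
    real line and are Lipschitz at 0 by [harnack]. The constant involves only M
    and s, in particular not the degrees of P and Q. *)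
Lemma spine_weight_lipschitz (P Q : {poly R[i]}) (s M p0 q0 p q x : R) :
  0 < s -> zero_free Q s -> (forall n, zero_free (spine P Q n) s) ->
  0 < p0 -> 0 < q0 -> P.[0] = p0%:C -> Q.[0] = q0%:C ->
  0 <= p -> 0 < q -> P.[x%:C] = p%:C -> Q.[x%:C] = q%:C ->
  p0 / q0 <= M -> p / q <= M -> `|x| <= s / 4 ->
  `|p / q - p0 / q0| <= 16 * (1 + M) ^+ 2 / s * `|x|.
Proof.
move=> s0 Qf Sf p00 q00 P0 Q0 p_0 q_0 Px Qx M0 Mx xs.
have [n0 hn] := spine_ratio_Re p00 q00 P0 Q0 Qf Sf.
have F y (a b : R) n : 0 < b -> P.[y] = a%:C -> Q.[y] = b%:C ->
    (spine P Q n.+1).[y] / (Q * spine P Q n).[y] =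
    (spine (a / b) 1 n.+1 / spine (a / b) 1 n)%:C.
  move=> b0 Py Qy; have b1 : b != 0 by rewrite gt_eqF.
  have b2 : b%:C != 0 by rewrite fmorph_eq0.
  rewrite hornerM !spine_horner Py Qy spine_ratio_homog // fmorph_div.
  by rewrite !(rmorph_spine (real_complex R)) /= fmorph_div rmorph1.
have r0 : 0 < s / 2 by lra.
have har n : (n0 <= n)%N ->
   `|spine (p / q) 1 n.+1 / spine (p / q) 1 n - spine (p0 / q0) 1 n.+1 / spine (p0 / q0) 1 n|
   <= 4 * (spine (p0 / q0) 1 n.+1 / spine (p0 / q0) 1 n) * (`|x| / (s / 2)).
  move=> n0n; have Bf : zero_free (Q * spine P Q n) (2 * (s / 2)).
    have -> : 2 * (s / 2) = s by field.
    move=> z zs.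
    by rewrite hornerM mulf_neq0 ?Qf ?Sf.
  have := @harnack _ (spine P Q n.+1) _ _ x%:C r0 Bf (hn n n0n).
  rewrite (F _ _ _ _ q_0 Px Qx) (F _ _ _ _ q00 P0 Q0) -rmorphB !modulus_real.
  by apply; lra.
have u0 : 0 <= p / q by rewrite divr_ge0 // ltW.
have v0 : 0 <= p0 / q0 by rewrite divr_ge0 // ltW.
move: (har n0 (leqnn _)) (har n0.+1 (leqnSn _)).
move: u0 v0 M0 Mx; set u := p / q; set v := p0 / q0 => u0 v0 vM uM.
have rec w : 0 <= w -> exists f g : R,
   [/\ spine w 1 n0.+1 / spine w 1 n0 = f, spine w 1 n0.+2 / spine w 1 n0.+1 = g,
     w = f * (g - 1), 1 <= f <= 1 + w & 1 <= g <= 1 + w].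
  move=> w0; exists (spine w 1 n0.+1 / spine w 1 n0), (spine w 1 n0.+2 / spine w 1 n0.+1).
  have [a1 a2 a3] := spine_real_bounds n0 w0.
  have [b1 b2 b3] := spine_real_bounds n0.+1 w0.
  split=> //.
  - by rewrite spineSS; field; rewrite !gt_eqF.
  - by rewrite ler_pdivlMr // mul1r a2 ler_pdivrMr.
  - by rewrite ler_pdivlMr // mul1r b2 ler_pdivrMr.
have [f [g [-> -> uE /andP[f1 f2] /andP[g1 g2]]]] := rec u u0.
have [f' [g' [-> -> vE /andP[f1' f2'] /andP[g1' g2']]]] := rec v v0.
have -> : `|x| / (s / 2) = 2 * `|x| / s by field; rewrite gt_eqF.
have -> : 16 * (1 + M) ^+ 2 / s * `|x| = 8 * (1 + M) ^+ 2 * (2 * `|x| / s).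
  by field; rewrite gt_eqF.
set d := 2 * `|x| / s; have d0 : 0 <= d by rewrite divr_ge0 ?mulr_ge0 // ltW.
move=> h1 h2.
have k1 : `|f - f'| <= 4 * (1 + M) * d by apply: le_trans h1 _; nra.
have k2 : `|g - g'| <= 4 * (1 + M) * d by apply: le_trans h2 _; nra.
have -> : u - v = (f - f') * (g - 1) + f' * (g - g') by rewrite uE vE; ring.
apply: le_trans (ler_normD _ _) _; rewrite !normrM.
rewrite (ger0_norm (_ : 0 <= g - 1)); last by lra.
rewrite (ger0_norm (_ : 0 <= f')); last by lra.
have l1 : `|f - f'| * (g - 1) <= 4 * (1 + M) * d * (1 + M).
  by rewrite ler_pM //; lra.
have l2 : f' * `|g - g'| <= (1 + M) * (4 * (1 + M) * d).
  by rewrite ler_pM //; lra.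
lra.
Qed.
End Weight.

(** * The real tree recursion *)

Section RealPart.
Variable R : realType.

Lemma is_derive_ln_poly (p : {poly R}) (x : R) : 0 < p.[x] ->
  is_derive x 1 (fun y : R => ln p.[y]) (p^`().[x] / p.[x]).
Proof.
move=> px; have hl := is_derive1_ln px.
have := @is_derive1_comp R (@ln R) (horner p) x _ _ hl (is_derive_poly p x).
by rewrite mulrC.
Qed.

(** Comparing products of powers of polynomials through their logarithmic
    derivatives, which stay rational functions of low degree. *)
Lemma log_combination_lt (p1 p2 p3 : {poly R}) (c1 c2 c3 a b : R) : a < b ->
  (forall x, a <= x <= b -> [/\ 0 < p1.[x], 0 < p2.[x] & 0 < p3.[x]]) ->
  (forall x, a < x < b -> 0 < c1 * (p1^`().[x] / p1.[x]) +
     c2 * (p2^`().[x] / p2.[x]) + c3 * (p3^`().[x] / p3.[x])) ->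
  c1 * ln p1.[a] + c2 * ln p2.[a] + c3 * ln p3.[a] <
  c1 * ln p1.[b] + c2 * ln p2.[b] + c3 * ln p3.[b].
Proof.
move=> ab pos dpos.
pose f (x : R) := c1 * ln p1.[x] + c2 * ln p2.[x] + c3 * ln p3.[x].
have df x : a <= x <= b -> is_derive x 1 f (c1 * (p1^`().[x] / p1.[x]) +
     c2 * (p2^`().[x] / p2.[x]) + c3 * (p3^`().[x] / p3.[x])).
  move=> /pos[h1 h2 h3].
  have d1 := is_deriveZ c1 (is_derive_ln_poly h1).
  have d2 := is_deriveZ c2 (is_derive_ln_poly h2).
  have d3 := is_deriveZ c3 (is_derive_ln_poly h3).
  exact: (is_deriveD (is_deriveD d1 d2) d3).
have sub x : x \in `]a, b[ -> a <= x <= b.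
  by rewrite in_itv /= => /andP[h1 h2]; rewrite !ltW.
apply: (@gtr0_derive1_lt_cc R f a b).
- by move=> x /sub/df[].
- move=> x xab; have [_ h] := df x (sub x xab).
  by rewrite derive1E h dpos //; move: xab; rewrite in_itv.
- apply: derivable_within_continuous => x; rewrite in_itv /= => xab.
  by have [] := df x xab.
- by rewrite in_itv /= lexx ltW.
- by rewrite in_itv /= lexx ltW.
- by [].
Qed.

Lemma derivXaddC (c : R) : ('X + c%:P)^`() = 1.
Proof. by rewrite derivD derivX derivC addr0. Qed.

Lemma ln_mul (x y : R) : 0 < x -> 0 < y -> ln (x * y) = ln x + ln y.
Proof. by move=> x0 y0; rewrite lnM ?posrE. Qed.

Lemma ln_exp (x : R) n : 0 < x -> ln (x ^+ n) = n%:R * ln x.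
Proof. by move=> x0; rewrite lnXn // mulr_natl. Qed.

(** The difference of the logarithmic derivatives is (d - 2)(d - 1) a^2 divided by
    positive factors, for d = e + 2. The two sides agree to second order at
    a = 0. *)
Lemma cycle_ineq e (a : R) : 0 < a ->
  (e.+2%:R + e.+1%:R * a) ^+ e.+2 <= (1 + a) ^+ e * (e.+2%:R + a) ^+ e.+2.
Proof.
move=> a0; case: e => [|e]; first by rewrite mul1r expr0 mul1r.
set n := e.+1; set d : R := n.+2%:R.
have nE : n%:R = d - 2 :> R by rewrite /d -(natr1 n.+1) -(natr1 n); ring.
have n1E : n.+1%:R = d - 1 :> R by rewrite /d -(natr1 n.+1); ring.
have d3 : 3 <= d by rewrite /d ler_nat.
have b1 : 0 < 1 + a by lra.
have b2 : 0 < d + a by lra.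
have b3 : 0 < d + (d - 1) * a by rewrite addr_gt0 ?mulr_gt0 //; lra.
have l0 : 0 < (d + (d - 1) * a) ^+ n.+2 by exact: exprn_gt0.
have r0 : 0 < (1 + a) ^+ n * (d + a) ^+ n.+2 by apply: mulr_gt0; exact: exprn_gt0.
rewrite n1E -ler_ln ?posrE //.
rewrite ln_mul ?ln_exp //; [|exact: exprn_gt0|exact: exprn_gt0].
rewrite -/d nE {nE n1E}; clear l0 r0; clearbody d.
have := @log_combination_lt ('X + 1%:P) ('X + d%:P) ((d - 1) *: 'X + d%:P)
  (d - 2) d (- d) 0 a a0.
rewrite !(derivXaddC, derivD, derivZ, derivX, derivC).
have X1 (y c : R) : ('X + c%:P).[y] = y + c by rewrite !hornerE.
have X2 (y : R) : ((d - 1) *: 'X + d%:P).[y] = (d - 1) * y + d by rewrite !hornerE.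
have X3 (y : R) : ((d - 1) *: 1 + 0).[y] = d - 1 by rewrite addr0 alg_polyC hornerC.
rewrite !X1 !X2 !mulr0 !add0r ln1 mulr0 add0r mulNr subrr.
move=> h; have {h} : 0 < (d - 2) * ln (a + 1) + d * ln (a + d) + - d * ln ((d - 1) * a + d).
  apply: h => [x /andP[x0 _]|x /andP[x0 _]].
    by rewrite !X1 !X2; split; [lra|lra|nra].
  rewrite !X1 !X2 X3 hornerC.
  have h1 : 0 < x + 1 by lra.
  have h2 : 0 < x + d by lra.
  have h3 : 0 < (d - 1) * x + d by nra.
  have -> : (d - 2) * (1 / (x + 1)) + d * (1 / (x + d)) + - d * ((d - 1) / ((d - 1) * x + d)) =
    (d - 2) * (d - 1) * x ^+ 2 / ((x + 1) * (x + d) * ((d - 1) * x + d)).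
    by field; rewrite !gt_eqF.
  by rewrite divr_gt0 ?mulr_gt0 ?exprn_gt0 //; lra.
by rewrite (addrC a 1) (addrC a d) (addrC _ d); lra.
Qed.

(** Equality holds at s = 1. The sign of the difference of the logarithmic
    derivatives is that of s^(d + 1) - (d + 1) s + d, positive by the
    Bernoulli inequality. *)
Lemma critical_ineq e (s : R) (d := e.+2%:R : R) : 1 < s ->
  d ^+ e.+2 * (s ^+ e.+2) ^+ e.+2 <
  (d * s - (d - 1)) * ((d - 1) * s ^+ e.+2 + 1) ^+ e.+2.
Proof.
move=> s1; have d2 : 2 <= d by rewrite /d ler_nat.
have b1 : 0 < s by lra.
have b2 : 0 < d * s - (d - 1) by nra.
have pol_gt0 (x : R) : 0 < x -> 0 < (d - 1) * x ^+ e.+2 + 1.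
  move=> x0; apply: addr_gt0 => //; apply: mulr_gt0; last exact: exprn_gt0.
  lra.
have b3 := pol_gt0 s b1.
have b4 : 0 < d by lra.
have l0 : 0 < d ^+ e.+2 * (s ^+ e.+2) ^+ e.+2.
  by apply: mulr_gt0; do ?apply: exprn_gt0.
have r0 : 0 < (d * s - (d - 1)) * ((d - 1) * s ^+ e.+2 + 1) ^+ e.+2.
  by apply: mulr_gt0 => //; exact: exprn_gt0.
rewrite -ltr_ln ?posrE //.
have [ld ls lp] : [/\ 0 < d ^+ e.+2, 0 < s ^+ e.+2 & 0 < ((d - 1) * s ^+ e.+2 + 1) ^+ e.+2].
  by split; exact: exprn_gt0.
rewrite (ln_mul ld (exprn_gt0 _ ls)) (ln_mul b2 lp) (ln_exp _ ls) !ln_exp // -/d.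
have B x : 1 <= x -> 1 + d * (x - 1) <= x ^+ e.+2.
  move=> x1; have := @bernoulli R (x - 1) e.+2; rewrite [1 + (x - 1)]addrC subrK.
  by apply; lra.
have dE : d = e.+2%:R by [].
clear l0 r0 ld; clearbody d.
have := @log_combination_lt (d *: 'X + (1 - d)%:P) ((d - 1) *: 'X^(e.+2) + 1%:P) 'X
  1 d (- (d * d)) 1 s s1.
have X1 (y c b : R) : (b *: 'X + c%:P).[y] = b * y + c by rewrite !hornerE.
have X2 (y b : R) : (b *: 'X^(e.+2) + 1%:P).[y] = b * y ^+ e.+2 + 1 by rewrite !hornerE.
have X3 (y : R) : (d *: 'X + (1 - d)%:P)^`().[y] = d.
  by rewrite derivD derivZ derivX derivC addr0 alg_polyC hornerC.
have X4 (y : R) : ((d - 1) *: 'X^(e.+2) + 1%:P)^`().[y] = (d - 1) * (d * y ^+ e.+1).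
  rewrite derivD derivZ derivXn derivC addr0 hornerZ hornerMn hornerXn.
  by rewrite dE mulr_natl.
rewrite !X1 !X2 !hornerX !expr1n !mulr1 !mul1r.
have -> : d + (1 - d) = 1 by ring.
have -> : d - 1 + 1 = d by ring.
rewrite ln1 mulr0 add0r addr0.
move=> h; have {h} : d * ln d < ln (d * s + (1 - d)) +
    d * ln ((d - 1) * s ^+ e.+2 + 1) + - (d * d) * ln s.
  apply: h => [x /andP[x1 _]|x /andP[x1 _]].
    rewrite X1 X2 hornerX; split; [nra| |lra].
    by apply: pol_gt0; lra.
  rewrite X3 X4 X1 X2 derivX hornerC hornerX mul1r (exprS x e.+1).
  have E0 : 0 < x ^+ e.+1 by rewrite exprn_gt0 //; lra.
  have {}B : 1 + d * (x - 1) <= x * x ^+ e.+1 by rewrite -exprS B // ltW.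
  set E := x ^+ e.+1 in E0 B *.
  have h1 : 0 < d * x + (1 - d) by nra.
  have h2 : 0 < (d - 1) * (x * E) + 1.
    by rewrite addr_gt0 ?mulr_gt0 //; lra.
  have h3 : 0 < x by lra.
  have -> : d / (d * x + (1 - d)) + d * ((d - 1) * (d * E) / ((d - 1) * (x * E) + 1)) +
    - (d * d) * (1 / x) =
    d * (d - 1) * (x * (x * E) - (d + 1) * x + d) /
      ((d * x + (1 - d)) * ((d - 1) * (x * E) + 1) * x).
    by field; rewrite !gt_eqF.
  rewrite divr_gt0 ?mulr_gt0 //; [lra|].
  have h4 : x * (1 + d * (x - 1)) <= x * (x * E) by rewrite ler_wpM2l // ltW.
  have h5 : 0 < d * (x - 1) ^+ 2 by rewrite mulr_gt0 ?exprn_gt0 ?subr_gt0.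
  nra.
have -> : d * s - (d - 1) = d * s + (1 - d) by ring.
by lra.
Qed.

Definition tree_step (d : nat) (l x : R) : R := l / (1 + x) ^+ d.

Lemma tree_step_gt0 d l x : 0 < l -> 0 <= x -> 0 < tree_step d l x.
Proof. by move=> l0 x0; rewrite divr_gt0 ?exprn_gt0 //; lra. Qed.

Lemma tree_step_le d l x y : 0 < l -> 0 <= x -> x <= y ->
  tree_step d l y <= tree_step d l x.
Proof.
move=> l0 x0 xy; rewrite ler_wpM2l ?(ltW l0) // lef_pV2 ?posrE ?exprn_gt0 //; try lra.
by rewrite lerXn2r ?nnegrE; lra.
Qed.

Lemma iter_step_gt0 d l k : 0 < l -> 0 < iter k (tree_step d l) l.
Proof. by move=> l0; elim: k => //= k IH; rewrite tree_step_gt0 // ltW. Qed.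

(** The map is decreasing, so its square is increasing; the square does not
    push y down, hence all even iterates of a point above y stay above y. *)
Lemma iter_step_lower d l (y w : R) k : 0 < l -> 0 < y -> 0 < w ->
  tree_step d l y <= w -> y <= tree_step d l w ->
  y <= iter k.*2 (tree_step d l) l.
Proof.
move=> l0 y0 w0 yw wy; elim: k => [|k IH].
  apply: le_trans wy _; rewrite ler_pdivrMr ?exprn_gt0 //; last by lra.
  by rewrite ler_peMr ?(ltW l0) // exprn_ege1 //; lra.
rewrite doubleS !iterS; apply: le_trans wy _; apply: tree_step_le => //.
  by rewrite ltW // tree_step_gt0 // ltW // iter_step_gt0.
by apply: le_trans yw; apply: tree_step_le => //; rewrite ltW.
Qed.

(** In the variable s = (1 + x) (d - 1) / d this is the inequality of
    [critical_ineq]. *)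
Lemma two_step_lt n (d x : R) : 1 < d ->
  (forall t, 1 < t -> d ^+ n * (t ^+ n) ^+ n <
     (d * t - (d - 1)) * ((d - 1) * t ^+ n + 1) ^+ n) ->
  (d - 1)^-1 < x ->
  tree_step n (d ^+ n / (d - 1) ^+ n.+1) (tree_step n (d ^+ n / (d - 1) ^+ n.+1) x) < x.
Proof.
move=> d1' ineq xcx; have d1 : 0 < d - 1 by lra.
have x1 : 1 < (d - 1) * x by rewrite -ltr_pdivrMl // mulr1.
pose s := 1 + ((d - 1) * x - 1) / d.
have s1 : 1 < s by rewrite ltrDl divr_gt0 //; lra.
have dn0 : d != 0 by rewrite gt_eqF //; lra.
have dn1 : d - 1 != 0 by rewrite gt_eqF.
have sn0 : s != 0 by rewrite gt_eqF //; lra.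
have -> : x = (d * s - (d - 1)) / (d - 1) by rewrite /s; field; rewrite dn1 dn0.
have f1 : tree_step n (d ^+ n / (d - 1) ^+ n.+1) ((d * s - (d - 1)) / (d - 1)) = ((d - 1) * s ^+ n)^-1.
  rewrite /tree_step; have -> : 1 + (d * s - (d - 1)) / (d - 1) = d * s / (d - 1) by field.
  rewrite expr_div_n exprMn (exprS (d - 1) n); field.
  by rewrite dn1 !expf_neq0.
rewrite f1 /tree_step.
have S0 : s ^+ n != 0 by rewrite expf_neq0.
have -> : 1 + ((d - 1) * s ^+ n)^-1 =
    ((d - 1) * s ^+ n + 1) / ((d - 1) * s ^+ n) by field; rewrite ?dn1 ?S0.
have p0 : 0 < (d - 1) * s ^+ n + 1.
  apply: addr_gt0 => //; apply: mulr_gt0 => //; apply: exprn_gt0; lra.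
rewrite expr_div_n (exprMn _ (d - 1)) (exprS (d - 1) n).
have -> : d ^+ n / ((d - 1) * (d - 1) ^+ n) /
   (((d - 1) * s ^+ n + 1) ^+ n / ((d - 1) ^+ n * s ^+ n ^+ n)) =
   d ^+ n * (s ^+ n) ^+ n / ((d - 1) * s ^+ n + 1) ^+ n / (d - 1).
  by field; rewrite dn1 (expf_neq0 _ S0) (expf_neq0 _ dn1) expf_neq0 // gt_eqF.
rewrite ltr_pM2r ?invr_gt0 // ltr_pdivrMr ?exprn_gt0 //.
exact: ineq.
Qed.

Lemma tree_step_fixed n (d : R) : 1 < d ->
  tree_step n (d ^+ n / (d - 1) ^+ n.+1) (d - 1)^-1 = (d - 1)^-1.
Proof.
move=> d1; have dn1 : d - 1 != 0 by rewrite gt_eqF // subr_gt0.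
have dn0 : d != 0 by rewrite gt_eqF //; lra.
rewrite /tree_step; have -> : 1 + (d - 1)^-1 = d / (d - 1) by field.
by rewrite expr_div_n (exprS (d - 1) n); field; rewrite dn1 !expf_neq0.
Qed.

Section Critical.
Variable e : nat.
Let d : R := e.+2%:R.
Let xc : R := (d - 1)^-1.
Let lc : R := d ^+ e.+2 / (d - 1) ^+ e.+3.

Lemma critical_two_step x : xc < x ->
  tree_step e.+2 lc (tree_step e.+2 lc x) < x.
Proof.
apply: two_step_lt => [|t]; [by rewrite /d ltr1n | exact: critical_ineq].
Qed.

Lemma critical_fixed : 0 < xc /\ tree_step e.+2 lc xc = xc.
Proof.
have d1 : 1 < d by rewrite /d ltr1n.
by split; [rewrite invr_gt0 subr_gt0 | exact: tree_step_fixed].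
Qed.

(** The even iterates decrease to a fixed point of the two-step map, and by
    [critical_two_step] the only one that is at least xc is xc itself. *)
Lemma critical_cvg y : xc < y -> exists K, forall k, (K <= k)%N ->
  iter k.*2 (tree_step e.+2 lc) lc <= y.
Proof.
move=> xcy; have d2 : 2 <= d by rewrite /d ler_nat.
have [xc0 xcf] := critical_fixed.
have lc0 : 0 < lc by rewrite divr_gt0 ?exprn_gt0 //; lra.
pose u k := iter k.*2 (tree_step e.+2 lc) lc.
have ux k : xc <= u k by apply: (@iter_step_lower _ _ _ xc); rewrite ?xcf.
have uS k : u k.+1 = tree_step e.+2 lc (tree_step e.+2 lc (u k)).
  by rewrite /u doubleS !iterS.
have un : nonincreasing_seq u.
  apply/nonincreasing_seqP => k; rewrite uS.
  have := ux k; rewrite [xc <= _]le_eqVlt => /orP[/eqP <-|/critical_two_step/ltW //].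
  by rewrite !xcf.
have uc : cvgn u.
  by apply: nonincreasing_is_cvgn => //; exists xc => _ [k _ <-].
set p := (limn u)%classic in uc.
have xp : xc <= p by apply: limr_ge => //; apply: nearW.
have cstep (v : nat -> R) (q : R) : 0 <= q -> (v @ \oo --> q)%classic ->
    ((fun k => tree_step e.+2 lc (v k)) @ \oo --> tree_step e.+2 lc q)%classic.
  move=> q0 vq; apply: cvgM; first exact: cvg_cst.
  apply: cvgV; first by rewrite expf_neq0 // gt_eqF //; lra.
  have h : ((fun k => 1 + v k) @ \oo --> 1 + q)%classic by apply: cvgD => //; exact: cvg_cst.
  exact: (cvg_comp _ _ h (@exprn_continuous R e.+2 (1 + q))).
have p0 : 0 <= p by lra.
have c2 := cstep _ _ (ltW (tree_step_gt0 e.+2 lc0 p0)) (cstep _ _ p0 uc).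
have pf : tree_step e.+2 lc (tree_step e.+2 lc p) = p.
  have c3 : ((fun k => u k.+1) @ \oo --> p)%classic by rewrite cvg_shiftS.
  have c4 : ((fun k => tree_step e.+2 lc (tree_step e.+2 lc (u k))) @ \oo --> p)%classic.
    by rewrite (_ : (fun k => _) = (fun k => u k.+1)) //; apply/funext => k; rewrite uS.
  exact: (cvg_unique _ c2 c4).
have pxc : p = xc.
  by move: xp; rewrite le_eqVlt => /orP[/eqP //|/critical_two_step]; rewrite pf ltxx.
have : (\forall k \near \oo, u k < y)%classic by apply: (cvgr_lt p uc); rewrite pxc.
by move=> [K _ hK]; exists K => k Kk; exact/ltW/hK.
Qed.

End Critical.

End RealPart.

(** * Contradiction at the critical activity *)

Section Final.
Variable R : realType.
Variable e : nat.
Variable d : R.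
Hypothesis dE : d = e.+2%:R.
Let xc : R := (d - 1)^-1.
Let lc : R := d ^+ e.+2 / (d - 1) ^+ e.+3.

Section TwoCycle.
Variable a : R.
Let y := xc * (1 + a).
Let w := xc / (1 + a).
Let l := w * (1 + y) ^+ e.+2.

Lemma two_cycle_params_gt0 : 0 < a -> [/\ 2 <= d, 0 < xc, 0 < lc, 0 < y & 0 < w].
Proof.
move=> a0; have d2 : 2 <= d by rewrite dE ler_nat.
have xc0 : 0 < xc by rewrite invr_gt0; lra.
have lc0 : 0 < lc by rewrite divr_gt0 ?exprn_gt0 //; lra.
by split => //; [apply: mulr_gt0 => //; lra | apply: divr_gt0 => //; lra].
Qed.

(** By definition of l the map sends y to w. The remaining inequality says that w
    is sent to y or beyond, and reduces to [cycle_ineq]. *)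
Lemma two_cycle_lower : 0 < a -> tree_step e.+2 l y = w /\ y <= tree_step e.+2 l w.
Proof.
move=> a0; have [d2 xc0 _ y0 w0] := two_cycle_params_gt0 a0.
split; first by rewrite /tree_step /l mulfK // expf_neq0 // gt_eqF //; lra.
rewrite /tree_step ler_pdivlMr ?exprn_gt0 //; last by lra.
have d1 : 0 < d - 1 by lra.
have b1 : 0 < 1 + a by lra.
have dn1 : d - 1 != 0 by rewrite gt_eqF.
have bn1 : 1 + a != 0 by rewrite gt_eqF.
have n1E : e.+1%:R = d - 1 :> R by rewrite dE -(natr1 e.+1); ring.
have := @cycle_ineq R e a a0; rewrite -dE n1E.
set X := d + (d - 1) * a; set Y := d + a => h.
have -> : 1 + w = X / ((d - 1) * (1 + a)) by rewrite /w /xc /X; field; rewrite ?bn1 ?dn1.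
rewrite /l; have -> : 1 + y = Y / (d - 1) by rewrite /y /xc /Y; field.
rewrite !expr_div_n (exprMn _ (d - 1)).
have -> : (1 + a) ^+ e.+2 = (1 + a) ^+ e * (1 + a) ^+ 2 by rewrite -exprD addn2.
set D := (d - 1) ^+ e.+2; set A := (1 + a) ^+ e in h *.
have D0 : 0 < D by rewrite exprn_gt0.
have A0 : 0 < A by rewrite exprn_gt0.
have -> : y * (X ^+ e.+2 / (D * (A * (1 + a) ^+ 2))) =
    (X ^+ e.+2 / A) * (xc / (1 + a) / D).
  by rewrite /y; field; rewrite !gt_eqF.
have -> : w * (Y ^+ e.+2 / D) = Y ^+ e.+2 * (xc / (1 + a) / D) by rewrite /w; ring.
rewrite ler_pM2r ?mulr_gt0 ?invr_gt0 // ler_pdivrMr // mulrC; exact: h.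
Qed.

(** Multiply by (1 - b / d)^d >= 1 - b and use (1 + b / d) (1 - b / d) <= 1. *)
Lemma expr_one_plus_upper (b : R) : 0 <= b -> b < 1 -> (1 + b / d) ^+ e.+2 * (1 - b) <= 1.
Proof.
move=> b0 b1; have d2 : 2 <= d by rewrite dE ler_nat.
have bd : b / d <= 1 by rewrite ler_pdivrMr; lra.
have bd0 : 0 <= b / d by rewrite divr_ge0 //; lra.
have := @bernoulli R (- (b / d)) e.+2; rewrite -dE mulrN mulrCA divff ?mulr1; last by rewrite gt_eqF //; lra.
move=> /(_ (ltac:(lra))) h.
apply: (@le_trans _ _ ((1 + b / d) ^+ e.+2 * (1 - b / d) ^+ e.+2)).
  by rewrite ler_wpM2l ?exprn_ge0 //; lra.
rewrite -exprMn exprn_ile1 //; nra.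
Qed.

(** The quotient l / lc equals (1 + a / d)^d / (1 + a), which is 1 to first order
    in a. This is the square root behaviour: a displacement of order a of the
    cycle costs only a^2 in the activity. *)
Lemma two_cycle_activity : 0 < a -> a <= 1 / 2 -> lc <= l <= lc * (1 + 2 * a ^+ 2).
Proof.
move=> a0 a1; have [d2 xc0 lc0 y0 w0] := two_cycle_params_gt0 a0.
have lE : l = lc * ((1 + a / d) ^+ e.+2 / (1 + a)).
  have d1 : d - 1 != 0 by rewrite gt_eqF //; lra.
  have d0 : d != 0 by rewrite gt_eqF //; lra.
  rewrite /l /w /lc; have -> : 1 + y = d * (1 + a / d) / (d - 1).
    by rewrite /y /xc; field; rewrite d1.
  rewrite expr_div_n exprMn (exprS (d - 1) e.+2) /xc; field.
  by rewrite d1 expf_neq0 // gt_eqF //; lra.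
rewrite lE; apply/andP; split.
  rewrite ler_pMr // ler_pdivlMr ?mul1r; last by lra.
  have := @bernoulli R (a / d) e.+2; rewrite -dE mulrCA divff ?mulr1; last by rewrite gt_eqF //; lra.
  by apply; have : 0 <= a / d by [rewrite divr_ge0 //; lra]; lra.
rewrite ler_pM2l // ler_pdivrMr; last by lra.
have a2 : a < 1 by lra.
have := expr_one_plus_upper (ltW a0) a2.
set E := (1 + a / d) ^+ e.+2 => h.
rewrite -(@ler_pM2r _ (1 - a)) //; last by lra.
apply: le_trans h _; have a4 : a ^+ 2 <= 1 / 4 by nra.
have : 0 <= a ^+ 2 * (1 / 2 - a ^+ 2) by rewrite mulr_ge0 ?sqr_ge0 //; lra.
lra.
Qed.
End TwoCycle.

Lemma cayley_ratio (l : R) k : 0 < l ->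
  [/\ 0 < poly_out l (cayley e.+2 k), 0 < poly_in l (cayley e.+2 k) &
   poly_in l (cayley e.+2 k) / poly_out l (cayley e.+2 k) =
   iter k (tree_step e.+2 l) l].
Proof.
move=> l0; elim: k => [|k [o0 i0 IH]].
  by rewrite poly_in_single poly_out_single divr1.
have -> : cayley e.+2 k.+1 = join_copies e.+2 (cayley e.+2 k) by [].
rewrite !join_copies_polys; split.
- by apply: exprn_gt0; exact: addr_gt0.
- by apply: mulr_gt0 => //; exact: exprn_gt0.
rewrite iterS -IH /tree_step; set o := poly_out _ _ in o0 *; set i := poly_in _ _ in i0 *.
have -> : 1 + i / o = (i + o) / o by field; rewrite gt_eqF.
by rewrite expr_div_n invf_div [RHS]mulrA.
Qed.

(** The activity of the path inside a caterpillar, after summing over the pendant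
    trees. *)
Definition weight (l : R) k :=
  l * poly_out l (cayley e.+2 k) ^+ e.+1 / indep_poly (cayley e.+2 k) l ^+ e.+1.

Lemma weightE l k : 0 < l ->
  weight l k = l / (1 + iter k (tree_step e.+2 l) l) ^+ e.+1.
Proof.
move=> l0; have [o0 i0 <-] := cayley_ratio k l0.
rewrite /weight indep_polyE; set o := poly_out _ _ in o0 *; set i := poly_in _ _ in i0 *.
have -> : 1 + i / o = (i + o) / o by field; rewrite gt_eqF.
by rewrite expr_div_n invf_div [RHS]mulrA.
Qed.

(** The polynomials are recentred at lc, so that the disc is centred at 0; the
    assumption on graphs provides the absence of zeros required by
    [spine_weight_lipschitz], through Cayley trees for Q and caterpillars for
    the spines. *)
Lemma cayley_weight_lipschitz (eta : R) k (x : R) : 0 < eta ->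
  (forall z : R[i], modulus z < eta -> forall G : sgraph, max_degree G = e.+3 ->
     indep_poly G (z + lc%:C) != 0) ->
  0 <= x -> x <= eta / 4 ->
  `|weight (lc + x) k.+2 - weight lc k.+2| <= 16 * (1 + (lc + eta)) ^+ 2 / eta * x.
Proof.
move=> eta0 free x0 xe.
have lc0 : 0 < lc by have [] := @two_cycle_params_gt0 1 ltr01.
pose T := cayley e.+2 k.+2.
pose X : {poly R[i]} := 'X + (lc%:C)%:P.
pose P := X * poly_out X T ^+ e.+1.
pose Q := indep_poly T X ^+ e.+1.
have XE z : X.[z] = z + lc%:C by rewrite hornerD hornerX hornerC.
have outE z : (poly_out X T).[z] = poly_out (z + lc%:C) T.
  by rewrite -XE; exact: (rmorph_poly_out (horner_eval z)).
have indE z (G : rooted) : (indep_poly G X).[z] = indep_poly G (z + lc%:C).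
  by rewrite -XE; exact: (rmorph_indep_poly (horner_eval z)).
have PE (z : R) : P.[z%:C] = ((lc + z) * poly_out (lc + z) T ^+ e.+1)%:C.
  rewrite hornerM horner_exp outE XE -rmorphD [z + lc]addrC.
  by rewrite -(rmorph_poly_out (real_complex R)) -rmorphXn -rmorphM.
have QE (z : R) : Q.[z%:C] = (indep_poly T (lc + z) ^+ e.+1)%:C.
  rewrite horner_exp indE -rmorphD [z + lc]addrC.
  by rewrite -(rmorph_indep_poly (real_complex R)) -rmorphXn.
have Qf : zero_free Q eta.
  move=> z ze; rewrite horner_exp expf_neq0 // indE free //.
  exact: cayley_max_degree.
have Sf n : zero_free (spine P Q n) eta.
  case: n => [|n] z ze; first by rewrite /= hornerC oner_eq0.
  by rewrite -[spine P Q n.+1](caterpillar_poly e.+2 k.+2 n X) indE free // caterpillar_degree.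
have pos (l : R) : 0 < l -> 0 < l * poly_out l T ^+ e.+1 /\ 0 < indep_poly T l ^+ e.+1.
  move=> l0; have [o0 i0 _] := cayley_ratio k.+2 l0.
  rewrite indep_polyE; split; last by apply: exprn_gt0; exact: addr_gt0.
  by apply: mulr_gt0 => //; exact: exprn_gt0.
have [p0 q0] := pos lc lc0.
have lx0 : 0 < lc + x by lra.
have [p1 q1] := pos (lc + x) lx0.
have wle l : 0 < l -> weight l k.+2 <= l.
  move=> l0; rewrite weightE //; have r0 := iter_step_gt0 e.+2 k.+2 l0.
  by rewrite ler_pdivrMr ?exprn_gt0 ?addr_gt0 // ler_peMr ?(ltW l0) // exprn_ege1 //; lra.
have P0 : P.[0] = (lc * poly_out lc T ^+ e.+1)%:C by have := PE 0; rewrite addr0.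
have Q0 : Q.[0] = (indep_poly T lc ^+ e.+1)%:C by have := QE 0; rewrite addr0.
have := @spine_weight_lipschitz R P Q eta (lc + eta) _ _ _ _ x eta0 Qf Sf p0 q0 P0 Q0
  (ltW p1) q1 (PE x) (QE x).
rewrite (ger0_norm x0); apply => //.
  by apply: le_trans (wle _ lc0) _; lra.
by apply: le_trans (wle _ lx0) _; lra.
Qed.

(** Going from lc to l moves the weight by at most C a^2, but the weight at lc is
    close to A = xc (1 + xc) while at l it is at most A (1 - a / 4). *)
Lemma no_zero_free_disc (eta : R) : 0 < eta ->
  (forall z : R[i], modulus z < eta -> forall G : sgraph, max_degree G = e.+3 ->
     indep_poly G (z + lc%:C) != 0) -> False.
Proof.
move=> eta0 free.
have [d2 xc0 lc0 _ _] := @two_cycle_params_gt0 1 ltr01.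
pose C := 16 * (1 + (lc + eta)) ^+ 2 / eta * (2 * lc).
pose A := xc * (1 + xc).
have A0 : 0 < A by rewrite mulr_gt0 //; lra.
have L0 : 0 <= 16 * (1 + (lc + eta)) ^+ 2 / eta.
  by apply: divr_ge0; [apply: mulr_ge0 => //; exact: sqr_ge0 | exact: ltW].
have C0 : 0 <= C by apply: mulr_ge0 => //; lra.
have AC0 : 0 < 8 * (A + C) by lra.
have lc8 : 0 < 8 * lc by lra.
(* The three bounds give a^2 small enough for the activity, x <= eta / 4, and
   (A + C) a^2 <= A a / 8. *)
pose a := Num.min (1 / 2) (Num.min (eta / (8 * lc)) (A / (8 * (A + C)))).
have a0 : 0 < a by rewrite !lt_min !divr_gt0.
have a1 : a <= 1 / 2 by rewrite ge_min lexx.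
have a2 : a <= eta / (8 * lc) by rewrite !ge_min lexx orbT.
have a3 : a <= A / (8 * (A + C)) by rewrite !ge_min lexx !orbT.
have a2' : 8 * lc * a <= eta by rewrite mulrC -ler_pdivlMr.
have a3' : 8 * (A + C) * a <= A by rewrite mulrC -ler_pdivlMr.
pose y := xc * (1 + a); pose w := xc / (1 + a); pose l := w * (1 + y) ^+ e.+2.
have [y0 w0] : 0 < y /\ 0 < w by have [] := two_cycle_params_gt0 a0.
have /andP[l1 l2] : lc <= l <= lc * (1 + 2 * a ^+ 2) := two_cycle_activity a0 a1.
have [c1 c2] : tree_step e.+2 l y = w /\ y <= tree_step e.+2 l w := two_cycle_lower a0.
pose x := l - lc.
have xl : l = lc + x by rewrite /x addrC subrK.
have x0 : 0 <= x by rewrite /x; lra.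
have x2 : x <= 2 * lc * a ^+ 2 by rewrite /x; lra.
have xe : x <= eta / 4.
  have : lc * a ^+ 2 <= lc * (a * 1) by rewrite ler_pM2l // expr2 ler_pM2l //; lra.
  lra.
(* At lc an error a^2 is affordable, since the gap below is of order a. *)
pose y2 := xc * (1 + a ^+ 2).
have xy2 : xc < y2 by rewrite ltr_pMr // ltrDl exprn_gt0.
have [K hK] := @critical_cvg R e y2 (ltac:(rewrite -dE; exact: xy2)).
rewrite -dE in hK.
have /hK R1 : (K <= K.+1)%N by [].
have lt0 : 0 < l by lra.
have R2 : y <= iter K.+1.*2 (tree_step e.+2 l) l.
  by apply: (@iter_step_lower _ _ _ _ w) => //; rewrite c1.
have := @cayley_weight_lipschitz eta K.*2 x eta0 free x0 xe.
rewrite -xl -doubleS !weightE //.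
set W1 := l / _; set W0 := lc / _ => lip.
have h1 : W1 <= A * ((1 + a / d) / (1 + a)).
  apply: (@le_trans _ _ (l / (1 + y) ^+ e.+1)).
    rewrite ler_wpM2l ?(ltW lt0) // lef_pV2 ?posrE ?exprn_gt0 //; try lra.
    by rewrite lerXn2r ?nnegrE //; lra.
  rewrite /l (exprS _ e.+1) mulrA mulfK; last by rewrite expf_neq0 // gt_eqF //; lra.
  have -> : w * (1 + y) = A * ((1 + a / d) / (1 + a)); last exact: lexx.
    rewrite /w /y /A /xc; field.
    by rewrite !gt_eqF //; lra.
have h0 : A * (1 - a ^+ 2) <= W0.
  have aa0 : 0 <= a ^+ 2 by exact: sqr_ge0.
  have aa1 : a ^+ 2 < 1 by nra.
  have B1 : 1 <= 1 + a ^+ 2 / d by rewrite lerDl divr_ge0 //; lra.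
  have B2 : (1 + a ^+ 2 / d) ^+ e.+1 * (1 - a ^+ 2) <= 1.
    apply: le_trans (expr_one_plus_upper aa0 aa1); rewrite ler_wpM2r //; first by lra.
    by rewrite ler_weXn2l.
  have B0 : 0 < (1 + a ^+ 2 / d) ^+ e.+1 by apply: exprn_gt0; lra.
  have r0 := iter_step_gt0 e.+2 K.+1.*2 lc0.
  have xcE : 1 + y2 = (1 + xc) * (1 + a ^+ 2 / d).
    by rewrite /y2 /xc; field; rewrite !gt_eqF //; lra.
  have xc1 : 0 < 1 + xc by lra.
  have lcE : lc = A * (1 + xc) ^+ e.+1.
    rewrite /A /lc -mulrA -exprS; have -> : 1 + xc = d / (d - 1).
      by rewrite /xc; field; rewrite !gt_eqF //; lra.
    rewrite expr_div_n (exprS (d - 1) e.+2) /xc invfM; ring.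
  apply: (@le_trans _ _ (lc / (1 + y2) ^+ e.+1)).
    rewrite xcE exprMn lcE -mulrA ler_pM2l // invfM mulVKf; last first.
      by rewrite expf_neq0 // gt_eqF.
    by rewrite -[X in _ <= X]mul1r ler_pdivlMr // mulrC.
  rewrite ler_wpM2l ?(ltW lc0) // lef_pV2 ?posrE.
  - by rewrite lerXn2r ?nnegrE; lra.
  - by apply: exprn_gt0; rewrite xcE mulr_gt0 //; lra.
  - by apply: exprn_gt0; lra.
have h2 : (1 + a / d) / (1 + a) <= 1 - a / 4.
  rewrite ler_pdivrMr; last by lra.
  have : a / d <= a / 2 by rewrite ler_pM2l // lef_pV2 ?posrE //; lra.
  nra.
have h3 : W0 - W1 <= C * a ^+ 2.
  have : W0 - W1 <= `|W1 - W0| by rewrite distrC ler_norm.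
  move=> h; apply: le_trans h _; apply: le_trans lip _.
  by rewrite /C -[X in _ <= X]mulrA ler_wpM2l.
have h4 : A * ((1 + a / d) / (1 + a)) <= A * (1 - a / 4) by rewrite ler_pM2l.
have h5 : A * (a / 4) <= (A + C) * a ^+ 2 by lra.
have h6 : (A + C) * a ^+ 2 <= A * a / 8.
  have : 8 * (A + C) * a * a <= A * a by rewrite ler_pM2r.
  lra.
have : 0 < A * a by rewrite mulr_gt0.
lra.
Qed.
End Final.

Theorem proposition1p2 (R : realType) (Delta : nat) (hDelta : (3 <= Delta)%N)
    (eta : R) (heta : 0 < eta) :
  exists lambda : R[i],
    `|lambda - (lambda_crit R Delta)%:C| < eta%:C /\
    exists G : sgraph, max_degree G = Delta /\ indep_poly G lambda = 0.
Proof.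
case: Delta hDelta => [|[|[|e]]] // _.
apply: boolp.contrapT => no_zero.
apply: (@no_zero_free_disc R e e.+2%:R erefl eta heta) => z ze G dG.
apply/eqP => Gz; apply: no_zero.
have crit : lambda_crit R e.+3 = e.+2%:R ^+ e.+2 / (e.+2%:R - 1) ^+ e.+3.
  by rewrite /lambda_crit subn1 subn2 /= -(natr1 e.+1) addrK.
exists (z + (lambda_crit R e.+3)%:C); split; last by exists G; rewrite crit.
by rewrite addrK normE ltcR.
Qed.
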